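(* The following two problems are polynomial-time equivalent. Problem 1: given a digraph $D=(V,A)$, a positive integer $k$ and a cost function $c:A\to\mathbb{R}_+$, find a minimum cardinality subset of $A$ containing at least one arc of every minimum cost $k$-arborescence. Problem 2: given a digraph $D=(V,A)$, a node $s\in V$, a positive integer $k$ and a cost function $c:A\to\mathbb{R}_+$, find a minimum cardinality subset of $A$ containing at least one arc of every minimum cost $s$-rooted $k$-arborescence.
   Context: A spanning arborescence is an arc set forming a spanning tree in the undirected sense in which every node has in-degree at most one; its root is the unique node of in-degree zero. A $k$-arborescence is the arc-disjoint union of $k$ spanning arborescences; it is $s$-rooted if all $k$ arborescences have root $s$. Minimum cost is taken among all $k$-arborescences (resp. all $s$-rooted $k$-arborescences) of $D$, the cost of an arc set being the sum of the costs of its arcs. *)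

(* Defs.v *)
From HB Require Import structures.
From mathcomp Require Import all_boot all_order all_algebra.
From mathcomp Require Import reals.

Set Implicit Arguments.
Unset Strict Implicit.
Unset Printing Implicit Defensive.
Import Order.TTheory GRing.Theory Num.Theory.
Local Open Scope ring_scope.

(** * Digraphs and k-arborescences *)

(* Parallel arcs and loops are allowed. *)
Record digraph := Digraph {
  node : finType;
  darc : finType;
  dtail : darc -> node;
  dhead : darc -> node }.

Definition joins (D : digraph) (a : darc D) (u v : node D) : bool :=
  ((dtail a == u) && (dhead a == v)) || ((dtail a == v) && (dhead a == u)).

Definition uadj (D : digraph) (F : {set darc D}) : rel (node D) :=
  fun u v => [exists a in F, joins a u v].

(* A cycle v_1 a_1 v_2 a_2 ... v_l a_l v_1 of the underlying undirected
   multigraph of F, as the list of the pairs (v_i, a_i); a loop is a cycle of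
   length 1, and two parallel or opposite arcs form a cycle of length 2. *)
Definition undirected_cycle (D : digraph) (F : {set darc D})
    (p : seq (node D * darc D)) : bool :=
  [&& p != [::], uniq (unzip1 p), uniq (unzip2 p), all (mem F) (unzip2 p)
    & cycle (fun x y => joins x.2 x.1 y.1) p].

Definition spanning_tree (D : digraph) (F : {set darc D}) : Prop :=
  (forall u v : node D, connect (uadj F) u v) /\
  (forall p, ~~ undirected_cycle F p).

Definition indeg (D : digraph) (F : {set darc D}) (v : node D) : nat :=
  #|[set a in F | dhead a == v]|.

Definition spanning_arborescence (D : digraph) (F : {set darc D}) : Prop :=
  spanning_tree F /\ (forall v, (indeg F v <= 1)%N).

Definition is_root (D : digraph) (F : {set darc D}) (r : node D) : Prop :=
  forall v, indeg F v = 0%N <-> v = r.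

Definition arborescence_packing (D : digraph) (k : nat)
    (T : 'I_k -> {set darc D}) (F : {set darc D}) : Prop :=
  [/\ forall i, spanning_arborescence (T i),
      forall i j, i != j -> [disjoint T i & T j]
    & F = \bigcup_(i < k) T i].

Definition k_arborescence (D : digraph) (k : nat) (F : {set darc D}) : Prop :=
  exists T : 'I_k -> {set darc D}, arborescence_packing T F.

Definition rooted_k_arborescence (D : digraph) (s : node D) (k : nat)
    (F : {set darc D}) : Prop :=
  exists T : 'I_k -> {set darc D},
    arborescence_packing T F /\ (forall i, is_root (T i) s).

(** * Minimum transversals of the minimum cost members of a family *)

Definition min_cost (R : realType) (A : finType) (c : A -> R)
    (P : {set A} -> Prop) (F : {set A}) : Prop :=
  P F /\ forall F', P F' -> \sum_(a in F) c a <= \sum_(a in F') c a.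

Definition set_transversal (A : finType) (P : {set A} -> Prop) (H : {set A}) :
    Prop :=
  forall F, P F -> H :&: F != set0.

Definition min_transversal (A : finType) (P : {set A} -> Prop) (H : {set A}) :
    Prop :=
  set_transversal P H /\ forall H', set_transversal P H' -> (#|H| <= #|H'|)%N.

(* On a one-node digraph the empty set is a k-arborescence, so that no
   transversal exists; the correct answer is then None. *)
Definition transversal_answer (A : finType) (P : {set A} -> Prop)
    (ans : option {set A}) : Prop :=
  if ans is Some H then min_transversal P H else forall H, ~ set_transversal P H.

(** * Computation with real numbers *)

Inductive data (R : Type) : Type :=
| DNil
| DReal of R
| DCons of data R & data R.
Arguments DNil {R}.

Fixpoint dsize (R : Type) (d : data R) : nat :=
  if d is DCons d1 d2 then (dsize d1 + dsize d2).+1 else 1%N.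

Definition dbool (R : Type) (b : bool) : data R :=
  if b then DCons DNil DNil else DNil.

Definition dtrue (R : Type) (d : data R) : bool :=
  if d is DCons _ _ then true else false.

(* The only operations on real numbers are the constant 1, addition,
   subtraction and comparison, each at unit cost.  Without multiplication, the
   numbers that arise in t steps from rational inputs have bit length at most
   linear in t plus the bit length of the input, so on rational inputs a
   polynomial bound on the cost gives a polynomial bound in the bit model. *)
Inductive expr : Type :=
| EVar of nat
| ENil
| ECons of expr & expr
| EHd of expr
| ETl of expr
| EOne
| EAdd of expr & expr
| ESub of expr & expr
| ELe of expr & expr.

Inductive cmd : Type :=
| CAssign of nat & expr
| CSeq of cmd & cmd
| CIf of expr & cmd & cmd
| CWhile of expr & cmd
| CQuery of nat & expr.

Definition store (R : Type) := nat -> data R.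

Definition update (R : Type) (st : store R) (x : nat) (d : data R) : store R :=
  fun y => if y == x then d else st y.

Fixpoint eval (R : realType) (st : store R) (e : expr) : data R :=
  match e with
  | EVar x => st x
  | ENil => DNil
  | ECons e1 e2 => DCons (eval st e1) (eval st e2)
  | EHd e1 => if eval st e1 is DCons d _ then d else DNil
  | ETl e1 => if eval st e1 is DCons _ d then d else DNil
  | EOne => DReal 1
  | EAdd e1 e2 => match eval st e1, eval st e2 with
                  | DReal x, DReal y => DReal (x + y)
                  | _, _ => DNil
                  end
  | ESub e1 e2 => match eval st e1, eval st e2 with
                  | DReal x, DReal y => DReal (x - y)
                  | _, _ => DNil
                  end
  | ELe e1 e2 => match eval st e1, eval st e2 with
                 | DReal x, DReal y => dbool R (x <= y)
                 | _, _ => DNil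
                 end
  end.

(* [exec O p st t st']: with oracle O, the program p started in the store st
   halts in the store st' at total cost t.  A command is charged for the size
   of the values it writes and of the query it asks; hence no value held in the
   store is larger than the input plus the cost so far. *)
Inductive exec (R : realType) (O : data R -> data R) :
    cmd -> store R -> nat -> store R -> Prop :=
| ExecAssign st x e :
    exec O (CAssign x e) st (dsize (eval st e)).+1 (update st x (eval st e))
| ExecSeq p q st st1 st2 t1 t2 :
    exec O p st t1 st1 -> exec O q st1 t2 st2 ->
    exec O (CSeq p q) st (t1 + t2).+1 st2
| ExecIfTrue e p q st st1 t :
    dtrue (eval st e) -> exec O p st t st1 -> exec O (CIf e p q) st t.+1 st1
| ExecIfFalse e p q st st1 t :
    ~~ dtrue (eval st e) -> exec O q st t st1 -> exec O (CIf e p q) st t.+1 st1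
| ExecWhileTrue e p st st1 st2 t1 t2 :
    dtrue (eval st e) -> exec O p st t1 st1 ->
    exec O (CWhile e p) st1 t2 st2 ->
    exec O (CWhile e p) st (t1 + t2).+1 st2
| ExecWhileFalse e p st :
    ~~ dtrue (eval st e) -> exec O (CWhile e p) st 1 st
| ExecQuery st x e :
    exec O (CQuery x e) st (dsize (eval st e) + dsize (O (eval st e))).+1
      (update st x (O (eval st e))).

Definition init_store (R : Type) (d : data R) : store R :=
  fun x => if x == 0%N then d else DNil.

(** * Search problems and polynomial-time reductions *)

Record problem (R : Type) := Problem {
  instance : Type;
  answer : instance -> Type;
  correct : forall I : instance, answer I -> Prop;
  enc_instance : instance -> data R;
  enc_answer : forall I : instance, answer I -> data R }.
Arguments correct {R} p I _.
Arguments enc_answer {R} p I _.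

Definition solves (R : Type) (P : problem R) (O : data R -> data R) : Prop :=
  forall I : instance P,
  exists2 a : answer I, correct P I a & O (enc_instance I) = enc_answer P I a.

Definition poly_time_reducible (R : realType) (P Q : problem R) : Prop :=
  exists (p : cmd) (b : {poly nat}),
  forall O : data R -> data R, solves Q O ->
  forall I : instance P,
  exists (t : nat) (st : store R) (a : answer I),
    [/\ exec O p (init_store (enc_instance I)) t st,
        (t <= b.[dsize (enc_instance I)])%N,
        st 0%N = enc_answer P I a
      & correct P I a].

Definition poly_time_equivalent (R : realType) (P Q : problem R) : Prop :=
  poly_time_reducible P Q /\ poly_time_reducible Q P.

(** * The two problems *)

(* The nodes are 0, ..., last_node, so there is at least one. *)
Record network (R : realType) := Network {
  last_node : nat;
  arcs : nat;
  arc_tail : 'I_arcs -> 'I_last_node.+1;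
  arc_head : 'I_arcs -> 'I_last_node.+1;
  nb_trees : nat;
  nb_trees_gt0 : (0 < nb_trees)%N;
  cost : 'I_arcs -> R;
  cost_ge0 : forall a, 0 <= cost a }.

Definition net_graph (R : realType) (N : network R) : digraph :=
  Digraph (@arc_tail R N) (@arc_head R N).

Record rooted_network (R : realType) := RootedNetwork {
  net :> network R;
  source : 'I_(last_node net).+1 }.

Definition dlist (R : Type) (l : seq (data R)) : data R :=
  foldr (@DCons R) DNil l.

Definition dunary (R : Type) (n : nat) : data R := dlist (nseq n DNil).

(* binary, least significant digit first *)
Definition dbinary (R : Type) (n : nat) : data R :=
  dlist [seq dbool R (odd (n %/ 2 ^ i)) | i <- iota 0 (trunc_log 2 n).+1].

(* Since the node set is part of the input, writing its nodes in unary changes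
   the size of the input only polynomially; k, which is not bounded by the size
   of the digraph, is written in binary. *)
Definition enc_network (R : realType) (N : network R) : data R :=
  dlist [:: dunary R (last_node N).+1;
            dlist [seq dlist [:: dunary R (arc_tail a); dunary R (arc_head a);
                                 DReal (cost a)]
                  | a <- enum 'I_(arcs N)];
            dbinary R (nb_trees N)].

Definition enc_rooted_network (R : realType) (N : rooted_network R) : data R :=
  DCons (dunary R (source N)) (enc_network N).

Definition enc_arc_set (R : Type) (m : nat) (ans : option {set 'I_m}) : data R :=
  if ans is Some H then DCons DNil (dlist [seq dbool R (a \in H) | a <- enum 'I_m])
  else DNil.

Definition blocking_k_arborescences (R : realType) : problem R := {|
  instance := network R;
  answer := fun N => option {set 'I_(arcs N)};
  correct := fun N => transversal_answer
    (min_cost (@cost R N) (@k_arborescence (net_graph N) (nb_trees N)));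
  enc_instance := @enc_network R;
  enc_answer := fun N => @enc_arc_set R (arcs N) |}.

Definition blocking_rooted_k_arborescences (R : realType) : problem R := {|
  instance := rooted_network R;
  answer := fun N => option {set 'I_(arcs N)};
  correct := fun N => transversal_answer
    (min_cost (@cost R N)
      (@rooted_k_arborescence (net_graph N) (source N) (nb_trees N)));
  enc_instance := @enc_rooted_network R;
  enc_answer := fun N => @enc_arc_set R (arcs N) |}.

(* Main.v *)
(* Rooted to unrooted: an arborescence contains no loop, so after every arc
   entering s has been replaced by a loop at s the k-arborescences are exactly
   the s-rooted ones, with the same arcs and costs.

   Unrooted to rooted: add a node s' and, for every node v, 2|A| parallel arcs
   s'v whose cost exceeds the cost of A. If D has a k-arborescence, the minimum
   cost s'-rooted k-arborescences are those of D with one new arc per root. A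
   minimum transversal has at most |A| arcs, so at least |A| >= k copies of each
   arc s'v avoid it, and what is left of it after dropping the new arcs is still
   a transversal for D. Whether D has a k-arborescence is decided by deleting
   new arcs greedily, as long as the oracle does not return the empty set (which
   it does iff there is no s'-rooted k-arborescence). By Edmonds' disjoint
   arborescences theorem, each arc s'v that survives has v in a tight set,
   maximal tight sets are disjoint, and hence at most k new arcs survive iff D
   has a k-arborescence. *)
Require Import Defs.
From mathcomp Require Import all_boot all_order all_algebra.
From mathcomp Require Import boolp reals zify lra.

Set Implicit Arguments.
Unset Strict Implicit.
Unset Printing Implicit Defensive.
Import Order.TTheory GRing.Theory Num.Theory.

(** * Arborescences and cuts *)

(** The undirected definition of an arborescence is exchanged at once for in-degrees and cuts
    ([rooted_arb]), so that adding or removing a root and Edmonds' theorem are arguments about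
    entering arcs, without cycles. The multiplicity is 2|A| and not k because k is written in
    binary: k copies per node could be exponentially many. As soon as D has two nodes and a
    k-arborescence, k <= |A|, and 2|A| leaves room both for k arcs and for the at most |A| arcs of a
    transversal. On one node that bound fails, and this case is answered directly. Existence has to
    be decided because a digraph without k-arborescence requires the empty set as its answer, while
    its extension may still have s'-rooted k-arborescences with more than k new arcs; the answer of
    the oracle then says nothing about D. The machine has no multiplication: multiplicities come
    from nested loops, and k is compared with the number of surviving arcs as a real number. *)

Definition enters (D : digraph) (X : {set node D}) (a : darc D) : bool :=
  (dhead a \in X) && (dtail a \notin X).

(** Reachability from [r] in cut form; [rooted_arbP] ties it to the undirected definition. *)
Definition rooted_arb (D : digraph) (F : {set darc D}) (r : node D) : Prop :=
  (forall v, indeg F v = (v != r)) /\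
  (forall X : {set node D}, r \notin X -> X != set0 -> exists2 a, a \in F & enters X a).

Lemma indeg_gt0P (D : digraph) (F : {set darc D}) v :
  reflect (exists2 a, a \in F & dhead a = v) (0 < indeg F v).
Proof.
apply: (iffP card_gt0P) => [[a]|[a aF <-]].
  by rewrite inE => /andP[aF /eqP <-]; exists a.
by exists a; rewrite inE aF eqxx.
Qed.

Lemma indeg_le1_inj (D : digraph) (F : {set darc D}) a b :
  indeg F (dhead a) <= 1 -> a \in F -> b \in F -> dhead b = dhead a -> b = a.
Proof.
move=> /card_le1_eqP le1 aF bF e.
by apply: le1; rewrite inE ?aF ?bF ?e eqxx.
Qed.

Lemma spanning_tree_no_loop (D : digraph) (F : {set darc D}) a :
  spanning_tree F -> a \in F -> dtail a != dhead a.
Proof.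
move=> [_ acyc] aF; apply/eqP => e.
have := acyc [:: (dtail a, a)].
by rewrite /undirected_cycle /= /joins /= aF -e !eqxx.
Qed.

Lemma uadj_sym (D : digraph) (F : {set darc D}) : symmetric (uadj F).
Proof. by move=> u v; apply: eq_existsb => a; rewrite /joins orbC. Qed.

(** The nodes reached from [r] by directed paths are closed under undirected adjacency: an arc
    traversed backwards from a reached node is, by in-degree at most one, the last arc of the path
    to it. So connectivity makes every node reachable, and a path that ends in [X] has an arc
    entering [X]. *)
Lemma root_rooted_arb (D : digraph) (F : {set darc D}) r :
  spanning_arborescence F -> indeg F r = 0 -> rooted_arb F r.
Proof.
move=> [[conn acyc] le1] r0.
pose e u v := [exists a in F, (dtail a == u) && (dhead a == v)].
have reach v : connect e r v.
  have clos : closed (uadj F) (connect e r).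
    apply: intro_closed; first exact/sym_connect_sym/uadj_sym.
    move=> u w /existsP[a /andP[aF /orP[]/andP[/eqP ta /eqP ha]]] ru.
      apply: connect_trans ru (connect1 _).
      by apply/existsP; exists a; rewrite aF ta ha !eqxx.
    have [p pth lst] := connectP ru.
    case: (lastP p) pth lst => [_ /= eu|q u' ].
      by have := introT (indeg_gt0P F r) (ex_intro2 _ _ a aF (etrans ha eu)); rewrite r0.
    rewrite rcons_path last_rcons => /andP[pq /existsP[b /andP[bF /andP[/eqP tb /eqP
        hb]]]] eu.
    have eb : b = a by apply: indeg_le1_inj => //; rewrite hb ha.
    by rewrite inE -ta -eb tb; apply/connectP; exists q.
  by have := closed_connect clos (conn r v); rewrite !inE connect0 => <-.
have ent (X : {set node D}) : r \notin X -> X != set0 -> exists2 a, a \in F & enters X a.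
  move=> rX /set0Pn[x xX]; have /connectP[p + lst] := reach x.
  elim: p r rX lst {conn reach r0} => [|y p IH] r rX /= lst.
    by rewrite -lst xX in rX.
  case/andP=> /existsP[a /andP[aF /andP[/eqP ta /eqP ha]]] pth.
  have [yX|yX] := boolP (y \in X); last exact: IH yX lst pth.
  by exists a => //; rewrite /enters ha yX ta.
split=> // v; have [->|vr] := eqVneq v r; first by rewrite r0.
apply/eqP; rewrite eqn_leq le1 /=; apply/indeg_gt0P.
have [||a aF /andP[]] := ent [set v]; first by rewrite inE eq_sym.
  by apply/set0Pn; exists v; rewrite inE.
by rewrite inE => /eqP <-; exists a.
Qed.

(** Without a node of in-degree zero, going backwards along chosen entering arcs would never stop
    and would close an undirected cycle. *)
Lemma arborescence_has_root (D : digraph) (F : {set darc D}) (v0 : node D) :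
  spanning_arborescence F -> exists r, rooted_arb F r.
Proof.
move=> arb; have [[_ acyc] le1] := arb.
have [r /eqP r0|no0] := pickP (fun v => indeg F v == 0).
  by exists r; apply: root_rooted_arb.
have inarc v : exists a, (a \in F) && (dhead a == v).
  have /indeg_gt0P[a aF <-] : 0 < indeg F v by rewrite lt0n no0.
  by exists a; rewrite aF eqxx.
pose f v := xchoose (inarc v).
have fF v : f v \in F by have /andP[] := xchooseP (inarc v).
have fh v : dhead (f v) = v by have /andP[_ /eqP] := xchooseP (inarc v).
pose p v := dtail (f v).
(* A node that reaches fewest nodes under the parent map [p] lies on a cycle of [p]: what [p v]
   reaches is contained in what [v] reaches, hence equal to it, hence contains [v]. *)
pose v := [arg min_(v < v0) #|connect (frel p) v|].
have vmin w : #|connect (frel p) v| <= #|connect (frel p) w|.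
  by rewrite /v; case: arg_minnP => // u _; apply.
have sub : connect (frel p) (p v) \subset connect (frel p) v.
  by apply/subsetP => w; apply: connect_trans; apply: connect1; rewrite /= eqxx.
have : v \in connect (frel p) (p v).
  have eqc : #|connect (frel p) (p v)| = #|connect (frel p) v|.
    by apply/eqP; rewrite eqn_leq vmin andbT subset_leq_card.
  by have /(subset_cardP eqc) -> := sub; apply: connect0.
case/connectP=> q0 pth lst; case/shortenP: pth lst => q pth uq _ lst.
have finj : injective f by move=> x y e; rewrite -(fh x) e fh.
pose c := [seq (x, f x) | x <- p v :: q].
have e1 : unzip1 c = p v :: q by rewrite /unzip1 -map_comp map_id.
have e2 : unzip2 c = map f (p v :: q) by rewrite /unzip2 -map_comp.
have /negP[] := acyc c; apply/and5P; split=> //.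
- by rewrite e1.
- by rewrite e2 (map_inj_uniq finj).
- by rewrite e2; apply/allP => _ /mapP[x _ ->]; apply: fF.
have pj x y : frel p x y -> joins (f x) x y.
  by move=> /eqP <-; rewrite /joins fh /p !eqxx orbT.
rewrite /c /= -map_rcons path_map; apply: (sub_path pj).
by rewrite rcons_path pth /= -lst eqxx.
Qed.

(** For acyclicity: a cycle has as many arcs as nodes and in-degrees are at most one, so each of its
    nodes is the head of one of its arcs. It thus avoids the root, and an arc of [F] entering its
    node set would share its head with a cycle arc, hence be that arc, whose tail is not outside. *)
Lemma rooted_arbP (D : digraph) (F : {set darc D}) r :
  rooted_arb F r <-> spanning_arborescence F /\ is_root F r.
Proof.
split=> [[deg ent]|[arb root]]; last by apply: root_rooted_arb => //; apply/root.
split; last first.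
  by move=> v; rewrite deg; split=> [|->]; [case: eqVneq|rewrite eqxx].
have le1 v : indeg F v <= 1 by rewrite deg; case: (_ != _).
split=> //; split.
  have main v : connect (uadj F) r v.
    pose X := [set v | ~~ connect (uadj F) r v].
    have [X0|X0] := eqVneq X set0.
      by move/setP/(_ v): X0; rewrite !inE => /negbFE.
    have rX : r \notin X by rewrite inE connect0.
    have [a aF] := ent X rX X0; rewrite /enters !inE negbK => /andP[/negP h t]; case: h.
    apply: connect_trans t (connect1 _); apply/existsP; exists a.
    by rewrite aF /joins !eqxx.
  move=> u v; apply: connect_trans (main v).
  by rewrite (sym_connect_sym (@uadj_sym _ F)).
move=> p; apply/negP => /and5P[p0 un ua /allP arcF cyc].
pose C := [set v in unzip1 p].
pose B := [set a in unzip2 p].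
have BC a : a \in B -> (dtail a \in C) && (dhead a \in C).
  rewrite inE => /mapP[[x b] xp /= ->].
  have nx := next_cycle cyc xp.
  have : (next p (x, b)).1 \in C by rewrite inE map_f // mem_next.
  have : x \in C by rewrite inE; apply: (map_f fst xp).
  by move: nx; rewrite /joins /= => /orP[]/andP[/eqP-> /eqP->] -> ->.
have hBC : @dhead D @: B = C.
  apply/eqP; rewrite eqEcard; apply/andP; split.
    by apply/subsetP => _ /imsetP[a aB ->]; case/andP: (BC a aB).
  rewrite card_in_imset.
    rewrite /B /C !cardsE (card_uniqP un) (card_uniqP ua) !size_map //.
  move=> a b; rewrite !inE => /arcF aF /arcF bF /esym e.
  by apply/esym/indeg_le1_inj.
have BF a : a \in B -> a \in F by rewrite inE => /arcF.
have rC : r \notin C.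
  apply/negP; rewrite -hBC => /imsetP[a aB re].
  by have := introT (indeg_gt0P F r) (ex_intro2 _ _ a (BF a aB) (esym re));
      rewrite deg eqxx.
have C0 : C != set0.
  case: p p0 @C @B {un ua arcF cyc BC hBC BF rC} => // x p _ C B.
  by apply/set0Pn; exists x.1; rewrite inE mem_head.
have [a aF /andP[]] := ent C rC C0.
rewrite -hBC => /imsetP[b bB e] /negP[].
rewrite hBC; have -> : a = b by apply: indeg_le1_inj (BF b bB) _ _ => //.
by case/andP: (BC b bB).
Qed.

(** * Cuts and packings of arborescences *)

Definition cut (D : digraph) (E : {set darc D}) (X : {set node D}) : nat :=
  #|[set a in E | enters X a]|.

Lemma cut_sum (D : digraph) (E : {set darc D}) X :
  cut E X = \sum_(a in E) enters X a.
Proof.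
rewrite /cut -sum1dep_card big_mkcondr; apply: eq_bigr => a _.
by case: (enters X a).
Qed.

Lemma cut_submod (D : digraph) (E : {set darc D}) X Y :
  cut E (X :&: Y) + cut E (X :|: Y) <= cut E X + cut E Y.
Proof.
rewrite !cut_sum -!big_split; apply: leq_sum => a _; rewrite /enters !inE.
by do 4 case: (_ \in _).
Qed.

Lemma indegU1 (D : digraph) (F : {set darc D}) a v :
  a \notin F -> indeg (a |: F) v = (dhead a == v) + indeg F v.
Proof.
move=> aF; rewrite /indeg.
have [e|ne] := eqVneq (dhead a) v.
  rewrite (_ : [set b in a |: F | dhead b == v] = a |: [set b in F | dhead b == v]).
    by rewrite cardsU1 inE (negPf aF).
  by apply/setP => b; rewrite !inE; case: eqVneq => // ->; rewrite e eqxx.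
apply: eq_card => b; rewrite !inE; case: (eqVneq b a) => //= ->.
by rewrite (negPf ne) andbF.
Qed.

(** The invariant of Lovasz's proof of Edmonds' theorem: [T] is an [s]-rooted arborescence on [S]
    only, and the arcs left over still satisfy the cut condition for [k] further arborescences. *)
Definition partial_arb (D : digraph) (E : {set darc D}) (s : node D) (k : nat)
    (S : {set node D}) (T : {set darc D}) : Prop :=
  [/\ s \in S, T \subset E, {in T, forall a, dhead a \in S} &
  [/\ forall v, indeg T v = (v \in S) && (v != s),
      forall X : {set node D}, s \notin X -> X :&: S != set0 ->
        exists2 a, a \in T & enters X a
    & forall X : {set node D}, s \notin X -> X != set0 -> k <= cut (E :\: T) X]].

(* The arc is taken inside an inclusionwise minimal tight set X that is not
   contained in S; a tight set Y it enters would make X :&: Y a smaller one. *)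
Lemma partial_arb_extend (D : digraph) (E : {set darc D}) s k S T :
  (forall X : {set node D}, s \notin X -> X != set0 -> k < cut E X) ->
  partial_arb E s k S T -> S != setT ->
  exists v T', v \notin S /\ partial_arb E s k (v |: S) T'.
Proof.
move=> cutE [sS TE Thd [deg ent cutT]] SnT.
pose tight (X : {set node D}) :=
  [&& s \notin X, X :\: S != set0 & cut (E :\: T) X == k].
(* More than [k] arcs of [E :\: T] enter [X :\: S], since the heads of [T] lie in [S]. They cannot
   all enter [X], so one has its tail in [X :&: S]. Admitting [X = setT], which no arc enters,
   covers the absence of tight sets. *)
have tight_arc X : tight X \/ X = setT ->
  exists2 a, a \in E :\: T & [/\ dtail a \in X, dtail a \in S, dhead a \in X & dhead a
      \notin S].
  move=> tX.
  have XS0 : X :\: S != set0.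
    case: tX => [/and3P[]//|->]; rewrite setTD.
    by apply: contraNneq SnT => e; rewrite -[S]setCK e setC0.
  have sXS : s \notin X :\: S by rewrite !inE sS.
  have lt : k < cut (E :\: T) (X :\: S).
    apply: leq_trans (cutE _ sXS XS0) _; apply/subset_leq_card/subsetP => a.
    rewrite /enters !inE => /andP[-> /andP[/andP[hS ->] ->]]; rewrite hS !andbT.
    by apply: contra hS; apply: Thd.
  have : ~~ ([set a in E :\: T | enters (X :\: S) a] \subset [set a in E :\: T | enters X
      a]).
    apply: contraTN lt => /subset_leq_card le; rewrite -leqNgt.
    apply: leq_trans le _; case: tX => [/and3P[_ _ /eqP <- //]|->].
    rewrite (_ : [set _ in _ | _] = set0) ?cards0 //.
    by apply/setP => a; rewrite /enters !inE !andbF.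
  case/subsetPn=> a; rewrite /enters !inE => /andP[aE /andP[/andP[hS hX] tn]].
  rewrite aE hX /= negbK => tX'; exists a; first by rewrite inE.
  by move: tn; rewrite tX' andbT negbK.
have [a aE [tS hS ok]] : exists2 a, a \in E :\: T &
  [/\ dtail a \in S, dhead a \notin S &
    forall Y, tight Y -> enters Y a -> False].
  have [X tX|none] := pickP tight; last first.
    have [a aE [_ tS _ hS]] := tight_arc setT (or_intror erefl).
    by exists a => //; split=> // Y; rewrite none.
  pose M := [arg min_(Y < X | tight Y) #|Y|].
  have [tM minM] : tight M /\ forall Y, tight Y -> #|M| <= #|Y|.
    by rewrite /M; case: arg_minnP.
  have [a aE [tM' tS hM hS]] := tight_arc M (or_introl tM).
  exists a => //; split=> // Y tY /andP[hY tY'].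
  have /and3P[sM _ /eqP cM] := tM; have /and3P[sY _ /eqP cY] := tY.
  have iS : (M :&: Y) :\: S != set0.
    by apply/set0Pn; exists (dhead a); rewrite !inE hS hM hY.
  have i0 : M :&: Y != set0.
    by apply: contraNneq iS => ->; rewrite set0D.
  have sI : s \notin M :&: Y by rewrite inE negb_and sM.
  have u0 : M :|: Y != set0 by apply/set0Pn; exists (dhead a); rewrite inE hM.
  have sU : s \notin M :|: Y by rewrite inE negb_or sM.
  have tI : tight (M :&: Y).
    rewrite /tight sI iS /=; have := cut_submod (E :\: T) M Y.
    have := cutT _ sI i0; have := cutT _ sU u0; rewrite cM cY.
    by move: (cut _ _) (cut _ _) => x y; clear; lia.
  have := minM _ tI; rewrite leqNgt => /negP[]; apply: proper_card.
  apply/properP; split; first exact: subsetIl.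
  by exists (dtail a) => //; rewrite inE (negPf tY') andbF.
have [aT aE'] : a \notin T /\ a \in E by move: aE; rewrite inE => /andP[].
have hs : dhead a != s by apply: contraNneq hS => ->.
(* Only a set of cut exactly [k] could fail, and [a] enters none: such a set would contain
   [dhead a], which is outside [S], and so be [tight]. *)
have cutT' (X : {set node D}) : s \notin X -> X != set0 -> k <= cut (E :\: (a |: T)) X.
  move=> sX X0; have := cutT X sX X0; rewrite leq_eqVlt => /orP[/eqP e|lt].
    have nent : ~~ (enters X a && (dhead a \in X)).
      apply/negP => /andP[en hX]; apply: (ok X) => //.
      by rewrite /tight sX e eqxx andbT; apply/set0Pn; exists (dhead a); rewrite inE hS.
    rewrite e; apply/subset_leq_card/subsetP => b; rewrite !inE.
    case/andP=> /andP[bT ->] en; rewrite negb_or bT en !andbT.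
    by apply: contraNneq nent => <-; rewrite en; case/andP: en.
  rewrite -ltnS; apply: leq_trans lt _; rewrite /cut.
  rewrite (cardsD1 a [set b in E :\: T | enters X b]).
  apply: leq_trans (leq_add (leq_b1 _) (leqnn _)) _; rewrite add1n ltnS.
  apply/subset_leq_card/subsetP => b; rewrite !inE negb_or.
  by case/and3P=> -> /andP[-> ->] ->.
exists (dhead a), (a |: T); split=> //; split.
- by rewrite !inE sS orbT.
- by rewrite subUset sub1set aE' TE.
- move=> b; rewrite !inE => /orP[/eqP->|/Thd ->]; first by rewrite eqxx.
  by rewrite orbT.
split=> // [v|X sX XS].
  rewrite indegU1 // deg inE; have [<-|ne] := eqVneq (dhead a) v.
    by rewrite inE eqxx (negPf hS) hs.
  by rewrite in_set1 (eq_sym v (dhead a)) (negPf ne).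
have [XS'|] := eqVneq (X :&: S) set0; last first.
  by move=> /(ent X sX)[b bT en]; exists b => //; rewrite inE bT orbT.
exists a; rewrite ?inE ?eqxx //.
have nX w : w \in S -> w \notin X.
  by move=> wS; have /setP/(_ w) := XS'; rewrite !inE wS andbT => ->.
rewrite /enters nX // andbT.
case/set0Pn: XS => w; rewrite !inE andb_orr => /orP[/andP[wX /eqP <-]//|/andP[wX wS]].
by have := nX w wS; rewrite wX.
Qed.

Lemma cut_arborescence (D : digraph) (E : {set darc D}) s k :
  (forall X : {set node D}, s \notin X -> X != set0 -> k < cut E X) ->
  exists T : {set darc D}, [/\ T \subset E, rooted_arb T s
    & forall X : {set node D}, s \notin X -> X != set0 -> k <= cut (E :\: T) X].
Proof.
move=> cutE.
suff [T [_ TE _ [deg ent cutT]]] : exists T, partial_arb E s k setT T.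
  exists T; split=> //; split=> [v|X sX X0]; first by rewrite deg inE.
  by apply: ent; rewrite ?setIT.
have ext n : forall S T, partial_arb E s k S T -> #|~: S| <= n ->
    exists T', partial_arb E s k setT T'.
  elim: n => [|n IH] S T pST.
    by rewrite leqn0 cards_eq0 => /eqP e; exists T; rewrite -(setCK S) e setC0 in pST.
  have [Se|SnT] := eqVneq S setT; first by exists T; rewrite Se in pST.
  have [v [T' [vS pS']]] := partial_arb_extend cutE pST SnT.
  move=> le; apply: IH pS' _; rewrite -ltnS; apply: leq_trans _ le.
  apply: proper_card; rewrite properC; apply/properP; split; first exact: subsetUr.
  by exists v; rewrite // !inE eqxx.
apply: (ext _ [set s] set0 _ (leqnn _)); split; rewrite ?inE ?sub0set //.
  by move=> a; rewrite !inE.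
split=> [v|X sX|X sX X0].
- rewrite inE andbN; apply/eqP; rewrite cards_eq0.
  by apply/eqP/setP => a; rewrite !inE.
- by case/set0Pn=> w; rewrite !inE => /andP[wX /eqP e]; rewrite -e wX in sX.
- by rewrite setD0; apply/ltnW/cutE.
Qed.

(* Edmonds' disjoint arborescences theorem. *)
Lemma cut_packing (D : digraph) (s : node D) k (E : {set darc D}) :
  (forall X : {set node D}, s \notin X -> X != set0 -> k <= cut E X) ->
  exists T : 'I_k -> {set darc D}, [/\ forall i, T i \subset E,
    forall i, rooted_arb (T i) s & forall i j, i != j -> [disjoint T i & T j]].
Proof.
elim: k E => [|k IH] E cutE; first by exists (fun=> set0); split; case.
have [T0 [T0E arb0 /IH[T [TE arbT disT]]]] := cut_arborescence cutE.
pose T' i := if unlift ord0 i is Some j then T j else T0.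
have T0d j : [disjoint T0 & T j].
  rewrite disjoint_sym; apply: disjointWl (TE j) _.
  by rewrite -setI_eq0 setIDAC setDIl setDv setI0.
exists T'; split=> [i|i|i j]; rewrite /T'.
- by case: unliftP => // j _; apply: subset_trans (TE j) (subsetDl _ _).
- by case: unliftP.
- case: unliftP => [i' ->|->]; case: unliftP => [j' ->|->] //; rewrite ?eqxx //.
    by rewrite (inj_eq lift_inj); apply: disT.
  by rewrite disjoint_sym.
Qed.

Lemma packing_rooted_arbP (D : digraph) (s : node D) k F :
  rooted_k_arborescence s k F <->
  exists T : 'I_k -> {set darc D}, [/\ forall i, rooted_arb (T i) s,
    forall i j, i != j -> [disjoint T i & T j] & F = \bigcup_(i < k) T i].
Proof.
split=> [[T [[arb dis ->] root]]|[T [arb dis ->]]]; exists T.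
  by split=> // i; apply/rooted_arbP.
by split=> [|i]; [split=> // i|]; have /rooted_arbP[] := arb i.
Qed.

(** One representative per member, distinct because the members are disjoint. It serves for cuts
    and, with [Q] trivial, for cardinalities. *)
Lemma disjoint_family_card (A : finType) k (T : 'I_k -> {set A}) (Q : pred A)
    (I : {set 'I_k}) :
  (forall i, i \in I -> exists2 a, a \in T i & Q a) ->
  (forall i j, i != j -> [disjoint T i & T j]) ->
  #|I| <= #|[set a in \bigcup_(i < k) T i | Q a]|.
Proof.
move=> ex dis.
pose f i := [pick a in T i | Q a].
have fP i : i \in I -> exists2 a, f i = Some a & (a \in T i) && Q a.
  rewrite /f => /ex[a aT Qa]; case: pickP => [b bP|/(_ a)]; first by exists b.
  by rewrite aT Qa.
rewrite -(card_in_imset (f := f)) => [|i j iI jI e].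
  rewrite -[X in _ <= X](card_imset (f := Some)) => [|x y []//].
  apply/subset_leq_card/subsetP => _ /imsetP[i iI ->].
  have [a -> /andP[aT Qa]] := fP i iI; rewrite imset_f // inE Qa andbT.
  by apply/bigcupP; exists i.
have [a ea /andP[aTi _]] := fP i iI; have [b eb /andP[bTj _]] := fP j jI.
apply/eqP; apply: contraTT isT => /dis /pred0P/(_ a).
by move: eb; rewrite -e ea /= aTi => -[->]; rewrite bTj.
Qed.

(** An arborescence with root outside [X] enters [X] by an arc of its own. The roots inside [X] make
    up for the others, as new arcs from an added root will do. *)
Lemma packing_cut (D : digraph) k (T : 'I_k -> {set darc D}) (r : 'I_k -> node D)
    (X : {set node D}) :
  (forall i, rooted_arb (T i) (r i)) ->
  (forall i j, i != j -> [disjoint T i & T j]) -> X != set0 ->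
  k <= #|[set i | r i \in X]| + cut (\bigcup_(i < k) T i) X.
Proof.
move=> arb dis X0; rewrite -[k in k <= _]card_ord.
rewrite -(cardsC [set i | r i \in X]) leq_add2l; apply: disjoint_family_card => // i.
by rewrite !inE => rX; apply: (arb i).2.
Qed.

Lemma cut_rooted_k_arborescenceP (D : digraph) (s : node D) k :
  (exists F, rooted_k_arborescence s k F) <->
  (forall X : {set node D}, s \notin X -> X != set0 -> k <= cut setT X).
Proof.
split=> [[F /packing_rooted_arbP[T [arb dis _]]] X sX X0|/cut_packing[T [_ arb dis]]].
  apply: leq_trans (packing_cut arb dis X0) _.
  rewrite (_ : [set i | s \in X] = set0) ?cards0 ?add0n; last first.
    by apply/setP => i; rewrite !inE (negPf sX).
  by apply/subset_leq_card/subsetP => a; rewrite !inE => /andP[].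
by exists (\bigcup_(i < k) T i); apply/packing_rooted_arbP; exists T.
Qed.

(** * Adding a root *)

(** Given by maps, to keep the combinatorics apart from the arc indices of the concrete network. As
    [phi] misses [s], no old arc leaves [s], so that an arc is new exactly when its tail is [s]. *)
Record root_extension (D D' : digraph) (s : node D') (phi : node D -> node D')
    (psi : darc D -> darc D') : Prop := RootExtension {
  phi_onto : forall v', v' != s -> exists v, v' = phi v;
  phi_neq : forall v, phi v != s;
  phi_inj : injective phi;
  psi_inj : injective psi;
  psi_tail : forall a, dtail (psi a) = phi (dtail a);
  psi_head : forall a, dhead (psi a) = phi (dhead a);
  fresh_arc : forall a', a' \notin codom psi -> dtail a' = s /\ dhead a' != s }.

Lemma packing_root_choice (D : digraph) k (F : {set darc D}) (v0 : node D) :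
  k_arborescence k F <->
  exists T : 'I_k -> {set darc D}, exists r : 'I_k -> node D,
    [/\ forall i, rooted_arb (T i) (r i),
      forall i j, i != j -> [disjoint T i & T j] & F = \bigcup_(i < k) T i].
Proof.
split=> [[T [arb dis ->]]|[T [r [arb dis ->]]]]; exists T; last first.
  by split=> // i; have /rooted_arbP[] := arb i.
have ex i : exists v, indeg (T i) v == 0.
  have [v [deg _]] := arborescence_has_root v0 (arb i).
  by exists v; rewrite deg eqxx.
exists (fun i => xchoose (ex i)); split=> // i.
by apply: root_rooted_arb => //; apply/eqP/(xchooseP (ex i)).
Qed.

Section RootExtension.
Variables (D D' : digraph) (s : node D') (phi : node D -> node D').
Variables (psi : darc D -> darc D').
Hypothesis ext : root_extension s phi psi.

Let phiE u v : (phi u == phi v) = (u == v) := inj_eq (phi_inj ext) u v.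

Lemma fresh_tail a' : (a' \notin codom psi) = (dtail a' == s).
Proof.
apply/idP/eqP => [/(fresh_arc ext)[]//|ts].
by apply/negP => /codomP[a e]; have := phi_neq ext (dtail a);
    rewrite -(psi_tail ext) -e ts eqxx.
Qed.

Lemma indeg_psi (F : {set darc D}) v : indeg (psi @: F) (phi v) = indeg F v.
Proof.
rewrite /indeg -(card_imset _ (psi_inj ext)); apply: eq_card => a'; rewrite inE.
apply/andP/imsetP => [[/imsetP[a aF ->]]|[a]].
  by rewrite (psi_head ext) phiE => ha; exists a; rewrite // inE aF.
by rewrite inE => /andP[aF ha] ->; rewrite imset_f // (psi_head ext) phiE.
Qed.

Lemma enters_psi (X' : {set node D'}) a :
  enters X' (psi a) = enters (phi @^-1: X') a.
Proof. by rewrite /enters !inE (psi_head ext) (psi_tail ext). Qed.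

(** Removing [e], the only new arc, deprives just [r] of its entering arc. As [e] enters no image of
    a set avoiding [r], the cuts to be checked are still met by old arcs. *)
Lemma restrict_arb (T' : {set darc D'}) e r :
  rooted_arb T' s -> e \in T' -> dhead e = phi r ->
  (forall a', a' \in T' -> a' \notin codom psi -> a' = e) -> e \notin codom psi ->
  rooted_arb (psi @^-1: T') r.
Proof.
move=> [deg ent] eT er uniq_e efresh.
have old a' : a' \in T' -> dhead a' != phi r -> exists2 a, a' = psi a & a \in psi @^-1: T'.
  move=> aT ha; have : a' \in codom psi.
    by apply: contraNT ha => /(uniq_e _ aT) ->; rewrite er.
  by case/codomP=> a e'; exists a; rewrite // inE -e'.
split=> [v|X rX X0].
  have le : indeg (psi @^-1: T') v <= indeg T' (phi v).
    rewrite -indeg_psi; apply/subset_leq_card/subsetP => a'; rewrite !inE.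
    by case/andP=> /imsetP[a + ->]; rewrite inE => ->.
  move: le; rewrite deg (phi_neq ext); have [->|vr] := eqVneq v r => le.
    apply/eqP; rewrite -leqn0 leqNgt; apply/negP => /indeg_gt0P[a].
    rewrite inE => aT ha; move: efresh; rewrite -(_ : psi a = e) ?codom_f //.
    apply: (@indeg_le1_inj _ T') => //; first by rewrite er deg (phi_neq ext).
    by rewrite (psi_head ext) ha er.
  apply/eqP; rewrite eqn_leq le; apply/indeg_gt0P.
  have /indeg_gt0P[a' aT ha] : 0 < indeg T' (phi v) by rewrite deg (phi_neq ext).
  have [|a ea aF] := old a' aT; first by rewrite ha phiE.
  by exists a => //; apply: (phi_inj ext); rewrite -(psi_head ext) -ea.
have [||a' aT en] := ent (phi @: X).
- by apply/imsetP=> -[v _ ev]; have := phi_neq ext v; rewrite -ev eqxx.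
- by case/set0Pn: X0 => v vX; apply/set0Pn; exists (phi v); apply: imset_f.
have [|a ea aF] := old a' aT.
  apply: contraNneq rX => ha; move: en; rewrite /enters ha => /andP[/imsetP[v vX]].
  by move/(phi_inj ext) => ->.
exists a => //; move: en; rewrite ea enters_psi; congr enters.
by apply/setP => v; rewrite inE mem_imset //; apply: (phi_inj ext).
Qed.

(** Each of the [k] arborescences has to leave [s], which only a new arc does; with at most [k] new
    arcs in all, each contains exactly one, whose head becomes the root. *)
Lemma restrict_packing (v0 : node D) k (F' : {set darc D'}) :
  rooted_k_arborescence s k F' -> #|F' :\: psi @: setT| <= k ->
  k_arborescence k (psi @^-1: F').
Proof.
case/packing_rooted_arbP=> T' [arb dis eF] few.
have ex i : exists a', (a' \in T' i) && (a' \notin codom psi).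
  have [||a' aT] := (arb i).2 (~: [set s]).
  - by rewrite !inE eqxx.
  - by apply/set0Pn; exists (phi v0); rewrite !inE (phi_neq ext).
  by rewrite /enters !inE negbK => /andP[_]; rewrite -fresh_tail => h; exists a';
      rewrite aT.
pose e i := xchoose (ex i).
have eP i : e i \in T' i /\ e i \notin codom psi by apply/andP/(xchooseP (ex i)).
have same i j a' : a' \in T' i -> a' \in T' j -> i = j.
  move=> ai aj; apply/eqP; apply: contraTT isT => /dis /pred0P/(_ a').
  by rewrite /= ai aj.
have einj : injective e 
  by move=> i j eij; apply: (same i j (e i)); [|rewrite eij]; apply: (eP _).1.
have im : e @: setT = F' :\: psi @: setT.
  apply/eqP; rewrite eqEcard card_imset // cardsT card_ord few andbT.
  apply/subsetP => _ /imsetP[i _ ->]; rewrite inE eF; apply/andP; split.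
    by apply: contra (eP i).2 => /imsetP[a _ ->]; apply: codom_f.
  by apply/bigcupP; exists i => //; apply: (eP i).1.
have uniq_e i a' : a' \in T' i -> a' \notin codom psi -> a' = e i.
  move=> aT fr; have : a' \in e @: setT.
    rewrite im inE eF; apply/andP; split.
      by apply: contra fr => /imsetP[a _ ->]; apply: codom_f.
    by apply/bigcupP; exists i.
  by case/imsetP=> j _ ea; rewrite ea (same i j a') // ea (eP j).1.
apply/(packing_root_choice _ _ v0); exists (fun i => psi @^-1: T' i).
have exr i : exists v, dhead (e i) == phi v.
  have [_ hs] := fresh_arc ext (eP i).2.
  by have [v ->] := phi_onto ext hs; exists v.
exists (fun i => xchoose (exr i)); split.
- move=> i; apply: (restrict_arb (arb i) (eP i).1) (eP i).2.
    exact/eqP/(xchooseP (exr i)).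
  exact: uniq_e.
- move=> i j ij; apply/pred0P => a /=; rewrite !inE.
  by have /pred0P/(_ (psi a)) := dis i j ij.
apply/setP => a; rewrite inE eF.
by apply/bigcupP/bigcupP => -[i _ h]; exists i => //; rewrite inE in h *.
Qed.

Lemma extend_arb (T : {set darc D}) e r :
  rooted_arb T r -> e \notin codom psi -> dhead e = phi r ->
  rooted_arb (e |: psi @: T) s.
Proof.
move=> [deg ent] efresh er.
have eT : e \notin psi @: T.
  by apply: contra efresh => /imsetP[a _ ->]; apply: codom_f.
have [te _] := fresh_arc ext efresh.
split=> [v'|X sX X0].
  have [->|/(phi_onto ext)[v ->]] := eqVneq v' s.
    apply/eqP; rewrite cards_eq0; apply/eqP/setP => a'; rewrite !inE.
    apply/negP => /andP[/orP[/eqP->|/imsetP[a _ ->]]].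
      by rewrite er (negPf (phi_neq ext _)).
    by rewrite (psi_head ext) (negPf (phi_neq ext _)).
  by rewrite indegU1 // indeg_psi er phiE deg eq_sym; case: eqP.
have X0' : phi @^-1: X != set0.
  case/set0Pn: X0 => v' vX; have [|v ev] := phi_onto ext (v' := v').
    by apply: contraNneq sX => <-.
  by apply/set0Pn; exists v; rewrite inE -ev.
have [rX|rX] := boolP (r \in phi @^-1: X).
  by exists e; rewrite ?inE ?eqxx // /enters er te sX andbT; rewrite inE in rX.
have [a aT en] := ent _ rX X0'.
by exists (psi a); rewrite ?inE ?imset_f ?orbT // enters_psi.
Qed.

Lemma extend_packing k (T : 'I_k -> {set darc D}) r (e : 'I_k -> darc D') :
  (forall i, rooted_arb (T i) (r i)) ->
  (forall i j, i != j -> [disjoint T i & T j]) ->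
  injective e -> (forall i, e i \notin codom psi) ->
  (forall i, dhead (e i) = phi (r i)) ->
  rooted_k_arborescence s k (psi @: (\bigcup_(i < k) T i) :|: e @: setT).
Proof.
move=> arb dis einj efresh er; apply/packing_rooted_arbP.
exists (fun i => e i |: psi @: T i); split=> [i|i j ij|].
- exact: extend_arb (arb i) (efresh i) (er i).
- apply/pred0P => a' /=; rewrite !inE; apply/negP => /andP[].
  case/orP=> [/eqP->|/imsetP[a aT ->]]; case/orP=> [|/imsetP[b bT]].
  + by rewrite (inj_eq einj) (negPf ij).
  + by move=> e'; have := efresh i; rewrite e' codom_f.
  + by move=> /eqP e'; have := efresh j; rewrite -e' codom_f.
  + move/(psi_inj ext) => e'; have /pred0P/(_ a) := dis i j ij.
    by rewrite /= aT e' bT.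
apply/setP => a'; rewrite inE; apply/orP/bigcupP.
  case=> [/imsetP[a /bigcupP[i _ aT] ->]|/imsetP[i _ ->]]; exists i => //.
    by rewrite !inE imset_f ?orbT.
  by rewrite !inE eqxx.
case=> i _; rewrite !inE => /orP[/eqP->|/imsetP[a aT ->]]; first by right; apply: imset_f.
by left; apply: imset_f; apply/bigcupP; exists i.
Qed.

End RootExtension.

(** With two nodes no arborescence is empty, and the [k] arborescences are disjoint. *)
Lemma k_arborescence_card (D : digraph) k (F : {set darc D}) :
  1 < #|node D| -> k_arborescence k F -> k <= #|F|.
Proof.
move=> n2; have [v0 _] : exists v0 : node D, v0 \in setT.
  by apply/set0Pn; rewrite -card_gt0 cardsT; lia.
move=> /(packing_root_choice _ _ v0)[T [r [arb dis ->]]].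
rewrite -[k in k <= _]card_ord -cardsT.
apply: leq_trans (disjoint_family_card (Q := predT) _ dis) _; last first.
  by apply/subset_leq_card/subsetP => a; rewrite inE => /andP[].
move=> i _; have [v vr] : exists v, v != r i.
  have : 0 < #|[set~ r i]| by rewrite cardsC1; lia.
  by case/card_gt0P=> v; rewrite !inE; exists v.
have /indeg_gt0P[a aT _] : 0 < indeg (T i) v by rewrite (arb i).1 vr.
by exists a.
Qed.

(** * Minimum cost sets and transversals of the extension *)

Section OptimalExtension.
Variables (R : realType) (D D' : digraph) (s : node D').
Variables (phi : node D -> node D') (psi : darc D -> darc D').
Hypothesis ext : root_extension s phi psi.
Variables (c : darc D -> R) (c' : darc D' -> R) (M : R).
Hypotheses (c_ge0 : forall a, (0 <= c a)%R) (c'_psi : forall a, c' (psi a) = c a).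
Hypotheses (c'_fresh : forall a', a' \notin codom psi -> c' a' = M).
Hypothesis M_gt : (\sum_a c a < M)%R.

Lemma fresh_codom a' : (a' \in psi @: setT) = (a' \in codom psi).
Proof. by apply/imsetP/codomP => -[a]; exists a. Qed.

Lemma extension_cost (F' : {set darc D'}) :
  (\sum_(a in F') c' a
   = \sum_(a in psi @^-1: F') c a + M *+ #|F' :\: psi @: setT|)%R.
Proof.
rewrite (big_setID (psi @: setT)) /=; congr (_ + _)%R; last first.
  rewrite -sumr_const; apply: eq_bigr => a'; rewrite inE fresh_codom => /andP[fr _].
  exact: c'_fresh.
have -> : F' :&: psi @: setT = psi @: (psi @^-1: F').
  apply/setP => a'; rewrite inE fresh_codom; apply/andP/imsetP.
    by case=> aF /codomP[a e]; exists a => //; rewrite inE -e.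
  by case=> a; rewrite inE => aF ->; rewrite aF codom_f.
rewrite big_imset /=; last by move=> a b _ _; apply: (psi_inj ext).
exact: eq_bigr.
Qed.

Lemma fresh_lower_bound (v0 : node D) k (F' : {set darc D'}) :
  rooted_k_arborescence s k F' -> k <= #|F' :\: psi @: setT|.
Proof.
case/packing_rooted_arbP=> T [arb dis eF].
have X0 : ~: [set s] != set0.
  by apply/set0Pn; exists (phi v0); rewrite !inE (phi_neq ext).
apply: leq_trans (packing_cut arb dis X0) _.
rewrite (_ : [set i | _] = set0) ?cards0 ?add0n; last first.
  by apply/setP => i; rewrite !inE eqxx.
apply/subset_leq_card/subsetP => a'; rewrite inE -eF => /andP[aF].
rewrite /enters !inE negbK fresh_codom => /andP[_ ta].
by rewrite (fresh_tail ext) ta.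
Qed.

(** Arborescence [i] takes copy number [i] among those at its root that avoid [H'], so arborescences
    with a common root still receive distinct new arcs. *)
Lemma extend_avoiding k (F : {set darc D}) (H' : {set darc D'}) (v0 : node D) :
  (forall v, k + #|H'| <= #|[set a' | (a' \notin codom psi) && (dhead a' == phi v)]|) ->
  k_arborescence k F ->
  exists F', [/\ rooted_k_arborescence s k F', psi @^-1: F' = F,
    #|F' :\: psi @: setT| = k & F' :&: H' \subset psi @: setT].
Proof.
move=> many /(packing_root_choice _ _ v0)[T [r [arb dis eF]]].
pose B v := [set a' | (a' \notin codom psi) && (dhead a' == phi v)].
pose av v := B v :\: H'.
have kav v : k <= #|av v|.
  rewrite -(leq_add2r #|H'|); apply: leq_trans (many v) _.
  by rewrite -(cardsID H') addnC leq_add2l subset_leq_card ?subsetIr.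
pose g v i := enum_val (widen_ord (kav v) i).
have gP v i : [/\ g v i \notin codom psi, dhead (g v i) = phi v & g v i \notin H'].
  have := enum_valP (widen_ord (kav v) i); rewrite -/(g v i) !inE.
  by case/and3P=> -> -> /eqP.
have ginj v : injective (g v).
  by move=> i j /enum_val_inj /(congr1 val) /= /val_inj.
pose e i := g (r i) i.
have einj : injective e.
  move=> i j eij; apply: (ginj (r i)); rewrite -/(e i) eij /e.
  suff -> : r i = r j by [].
  have [_ hi _] := gP (r i) i; have [_ hj _] := gP (r j) j.
  by apply: (phi_inj ext); rewrite -hi -hj -/(e i) eij.
have eP i : [/\ e i \notin codom psi, dhead (e i) = phi (r i) & e i \notin H'] := gP _ _.
have efr i : e i \notin codom psi by have [] := eP i.
have rk := extend_packing ext arb dis einj efr (fun i => let: And3 _ h _ := eP i in h).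
have dif : (psi @: (\bigcup_(i < k) T i) :|: e @: setT) :\: psi @: setT = e @: setT.
  apply/setP => a'; rewrite !inE fresh_codom; apply/andP/imsetP.
    case=> fr /orP[/imsetP[a _ ea]|/imsetP[i _ ->]]; last by exists i.
    by rewrite ea codom_f in fr.
  by case=> i _ ->; rewrite efr imset_f ?orbT.
exists (psi @: (\bigcup_(i < k) T i) :|: e @: setT); split=> //.
- rewrite eF; apply/setP => a; rewrite !inE (mem_imset _ _ (psi_inj ext)).
  apply/orP/idP => [[//|/imsetP[i _ ea]]|->]; last by left.
  by have := efr i; rewrite -ea codom_f.
- by rewrite dif card_imset // cardsT card_ord.
apply/subsetP => a'; rewrite !inE => /andP[/orP[/imsetP[a _ ->]|/imsetP[i _ ->]] aH].
  by rewrite imset_f.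
by have [_ _] := eP i; rewrite aH.
Qed.

(** Restriction and lifting change costs by the constant [M *+ k], so minimum cost sets correspond
    ([restr], [lift]). A transversal for [D] maps to one for the extension, which yields both the
    bound on [H'] that [avoid] requires and the minimality of the preimage. *)
Lemma extension_answer k (ans : option {set darc D'}) :
  1 < #|node D| -> 0 < k ->
  (forall v, (#|darc D|).*2 <=
     #|[set a' | (a' \notin codom psi) && (dhead a' == phi v)]|) ->
  (exists F : {set darc D}, k_arborescence k F) ->
  transversal_answer (min_cost c' (rooted_k_arborescence s k)) ans ->
  exists2 H', ans = Some H' &
    transversal_answer (min_cost c (@k_arborescence D k)) (Some (psi @^-1: H')).
Proof.
move=> n2 k0 many [F0 arbF0].
have [v0 _] : exists v0 : node D, v0 \in setT.
  by apply/set0Pn; rewrite -card_gt0 cardsT; lia.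
have kA : k <= #|darc D|.
  by apply: leq_trans (k_arborescence_card n2 arbF0) (max_card _).
have avoid F (H' : {set darc D'}) : #|H'| <= #|darc D| -> k_arborescence k F ->
    exists F', [/\ rooted_k_arborescence s k F', psi @^-1: F' = F,
    #|F' :\: psi @: setT| = k & F' :&: H' \subset psi @: setT].
  move=> leH; apply: extend_avoiding => // v; apply: leq_trans (many v).
  by rewrite -addnn leq_add.
have cost_le (F : {set darc D}) : (\sum_(a in F) c a <= \sum_a c a)%R.
  rewrite [leRHS](bigID (mem F)) /= lerDl; exact: sumr_ge0.
have M0 : (0 < M)%R by apply: le_lt_trans M_gt; apply: sumr_ge0.
have restr F' : min_cost c' (rooted_k_arborescence s k) F' ->
    min_cost c (@k_arborescence D k) (psi @^-1: F').
  case=> rF' minF'.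
  (* One new arc too many costs a further [M], more than all old arcs together, and so loses against
     [F0] lifted with [k] new arcs. *)
  have few : #|F' :\: psi @: setT| <= k.
    have [||F1 [rF1 e1 k1 _]] := avoid F0 set0; rewrite ?cards0 //.
    have := minF' _ rF1; rewrite !extension_cost e1 k1 => le.
    rewrite leqNgt; apply/negP => gt; move: le; apply/negP; rewrite -ltNge.
    have : (M *+ k.+1 <= M *+ #|F' :\: psi @: setT|)%R by rewrite ler_pMn2l.
    have : (0 <= \sum_(a in psi @^-1: F') c a)%R by apply: sumr_ge0.
    have := cost_le F0; rewrite mulrS; move: M_gt.
    set x1 := (\sum_a c a)%R; set x2 := (\sum_(a in F0) _)%R; set x3 := (\sum_(a in _) _)%R.
    set x4 := (M *+ k)%R; set x5 := (M *+ _)%R; lra.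
  have keq : #|F' :\: psi @: setT| = k.
    by apply/eqP; rewrite eqn_leq few (fresh_lower_bound v0).
  split; first exact: (restrict_packing ext v0 rF' few).
  move=> F arbF; have [||F1 [rF1 e1 k1 _]] := avoid F set0; rewrite ?cards0 //.
  by have := minF' _ rF1; rewrite !extension_cost e1 k1 keq lerD2r.
have lift F F' : min_cost c (@k_arborescence D k) F -> rooted_k_arborescence s k F' ->
    psi @^-1: F' = F -> #|F' :\: psi @: setT| = k ->
    min_cost c' (rooted_k_arborescence s k) F'.
  move=> [arbF minF] rF' eF ek; split=> // F1 rF1; rewrite !extension_cost eF ek.
  have [le|gt] := leqP #|F1 :\: psi @: setT| k.
    have -> : #|F1 :\: psi @: setT| = k.
      by apply/eqP; rewrite eqn_leq le (fresh_lower_bound v0).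
    by rewrite lerD2r; apply/minF/(restrict_packing ext v0 rF1 le).
  have : (M *+ k.+1 <= M *+ #|F1 :\: psi @: setT|)%R by rewrite ler_pMn2l.
  have : (0 <= \sum_(a in psi @^-1: F1) c a)%R by apply: sumr_ge0.
  have := cost_le F; rewrite mulrS; move: M_gt.
  set x1 := (\sum_a c a)%R; set x2 := (\sum_(a in F) _)%R; set x3 := (\sum_(a in _) _)%R.
  set x4 := (M *+ k)%R; set x5 := (M *+ _)%R; lra.
have imageT (H : {set darc D}) : set_transversal (min_cost c (@k_arborescence D k)) H ->
    set_transversal (min_cost c' (rooted_k_arborescence s k)) (psi @: H).
  move=> tH F' /restr/tH/set0Pn[a]; rewrite !inE => /andP[aH aF].
  by apply/set0Pn; exists (psi a); rewrite inE imset_f.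
have allT : set_transversal (min_cost c (@k_arborescence D k)) setT.
  move=> F [arbF _]; rewrite setTI -card_gt0.
  exact: leq_trans k0 (k_arborescence_card n2 arbF).
case: ans => [H'|/(_ (psi @: setT))[]]; last exact: imageT.
case=> tH' minH'; exists H' => //.
have leH' : #|H'| <= #|darc D|.
  by apply: leq_trans (minH' _ (imageT _ allT)) _; rewrite card_imset ?cardsT //;
      apply: (psi_inj ext).
split=> [F optF|H tH].
  have [F' [rF' eF ek sub]] := avoid F H' leH' optF.1.
  have /set0Pn[a' aH] := tH' F' (lift _ _ optF rF' eF ek).
  have /imsetP[a _ ea] : a' \in psi @: setT by apply: (subsetP sub); rewrite setIC.
  by apply/set0Pn; exists a; move: aH; rewrite -eF !inE -ea.
apply: leq_trans (_ : #|H'| <= _).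
  rewrite -(card_imset _ (psi_inj ext)); apply/subset_leq_card/subsetP.
  by move=> _ /imsetP[a + ->]; rewrite inE.
by rewrite -(card_imset _ (psi_inj ext)); apply/minH'/imageT.
Qed.

End OptimalExtension.

(** * Counting with tight sets *)

Lemma count_mem_sum (V : finType) (K : seq V) (X : {set V}) :
  count (mem X) K = \sum_(v in X) count_mem v K.
Proof.
elim: K => [|u K IH] /=; first by rewrite big1.
rewrite big_split /= -IH; congr (_ + _).
have [uX|uX] := boolP (u \in X).
  by rewrite (bigD1 u) //= eqxx big1 ?addn0 // => v /andP[_ /negPf]; rewrite eq_sym => ->.
by rewrite big1 // => v vX; case: eqVneq uX => // ->; rewrite vX.
Qed.

(* The maximal tight sets are disjoint and cover K. *)
Lemma tight_cover_size (V : finType) (K Y : seq V) (rho : {set V} -> nat) k :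
  (forall X Z, rho (X :&: Z) + rho (X :|: Z) <= rho X + rho Z) ->
  (forall X : {set V}, X != set0 -> k <= count (mem X) K + rho X) ->
  (forall v, v \in K -> exists2 X : {set V}, v \in X & count (mem X) K + rho X <= k) ->
  (forall X : {set V}, X != set0 -> k <= count (mem X) Y + rho X) ->
  size K <= size Y.
Proof.
move=> sub feas tightK root.
pose tight (X : {set V}) := count (mem X) K + rho X <= k.
(* Counting in [K] is modular and [rho] is submodular; the intersection contains [v], so its value
   is at least [k], which leaves at most [k] for the union. *)
have tightU (X Z : {set V}) v : tight X -> tight Z -> v \in X -> v \in Z -> tight (X :|: Z).
  move=> tX tZ vX vZ; have := sub X Z.
  have I0 : X :&: Z != set0 by apply/set0Pn; exists v; rewrite inE vX.
  have e : count (mem (X :&: Z)) K + count (mem (X :|: Z)) K = count (mem X) K + count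
      (mem Z) K.
    rewrite -(count_predUI (mem X)) addnC; congr (_ + _); apply: eq_count => w;
        by rewrite /= !inE.
  move: (feas _ I0) tX tZ e; rewrite /tight.
  move: (count _ _) (count _ _) (count _ _) (count _ _) => c1 c2 c3 c4.
  by move: (rho _) (rho _) (rho _) (rho _) => r1 r2 r3 r4; clear; lia.
pose maxtight v X := [&& tight X, v \in X &
  [forall Z : {set V}, tight Z && (v \in Z) ==> (#|Z| <= #|X|)]].
pose M v := odflt set0 [pick X | maxtight v X].
have MP v : v \in K -> maxtight v (M v).
  rewrite /M => /tightK[X0 vX0 tX0];
      case: pickP => // /(_ [arg max_(X > X0 | tight X && (v \in X)) #|X|]).
  case: arg_maxnP => [|X /andP[tX vX] mX]; first by rewrite /tight tX0.
  suff -> : maxtight v X by [].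
  by rewrite /maxtight tX vX; apply/forallP => Z; apply/implyP/mX.
pose P := M @: [set v in K].
have trivP : trivIset P.
  apply/trivIsetP => _ _ /imsetP[u uK ->] /imsetP[v vK ->]; apply: contraNT.
  rewrite !inE in uK vK; case/pred0Pn=> w /andP[/= wu wv].
  have /and3P[tu uu /forallP mu] := MP _ uK; have /and3P[tv vv /forallP mv] := MP _ vK.
  have tU := tightU _ _ _ tu tv wu wv.
  have eu : M u = M u :|: M v.
    apply/eqP; rewrite eqEcard subsetUl; apply: (implyP (mu _)).
    by rewrite tU inE uu.
  have ev : M v = M u :|: M v.
    apply/eqP; rewrite eqEcard subsetUr; apply: (implyP (mv _)).
    by rewrite tU inE vv orbT.
  by rewrite eu -ev.
have count_cover L : count (mem (cover P)) L = \sum_(X in P) count (mem X) L.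
  rewrite count_mem_sum big_trivIset //=.
  by apply: eq_bigr => X _; rewrite count_mem_sum.
have -> : size K = count (mem (cover P)) K.
  apply/esym/eqP; rewrite -all_count; apply/allP => v vK.
  apply/bigcupP; exists (M v); first by rewrite imset_f ?inE.
  by have /and3P[] := MP v vK.
(* On a maximal tight set, [K] has at most [k - rho] entries and [Y] at least as many; the sets
   being disjoint, the inequalities add up. *)
apply: leq_trans (count_size (mem (cover P)) Y); rewrite !count_cover; apply: leq_sum.
move=> _ /imsetP[v vK ->]; rewrite inE in vK; have /and3P[tv vv _] := MP v vK.
rewrite -(leq_add2r (rho (M v))); apply: leq_trans tv (root _ _).
by apply/set0Pn; exists v.
Qed.

(** * The extended network *)

Lemma min_cost_exists (R : realType) (A : finType) (c : A -> R)
    (P : {set A} -> Prop) F : P F -> exists F', min_cost c P F'.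
Proof.
move=> PF; pose w (F : {set A}) := (\sum_(a in F) c a)%R.
pose b F := `[< P F >]; have bF : b F by apply/asboolP.
exists [arg min_(F' < F | b F') w F']%O.
by case: (arg_minP w bF) => F' /asboolP PF' h; split=> // F2 PF2; apply/h/asboolP.
Qed.

(** Together with the nonempty case below, this turns an answer into an existence test. *)
Lemma transversal_answer_empty (A : finType) (P : {set A} -> Prop) ans :
  (forall F, ~ P F) -> transversal_answer P ans -> ans = Some set0.
Proof.
move=> noF; case: ans => [H [_ minH]|/(_ set0)[]]; last by move=> F /noF.
congr Some; apply/eqP; rewrite -cards_eq0 -leqn0 -(cards0 A); apply: minH.
by move=> F /noF.
Qed.

Lemma transversal_answer_nonempty (A : finType) (P : {set A} -> Prop) ans F :
  P F -> (forall F, P F -> F != set0) -> transversal_answer P ans ->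
  exists2 H, ans = Some H & H != set0.
Proof.
move=> PF n0; case: ans => [H [tH _]|/(_ setT)[]].
  by exists H => //; apply: contraNneq (tH F PF) => ->; rewrite set0I.
by move=> F' /n0; rewrite setTI.
Qed.

Lemma card_tnth_count (T : Type) (L : seq T) (P : pred T) :
  #|[set i : 'I_(size L) | P (tnth (in_tuple L) i)]| = count P L.
Proof.
rewrite -sum1dep_card -[L in RHS]/(tval (in_tuple L)) -[in RHS]map_tnth_enum.
by rewrite count_map -sum1_count /= big_enum_cond.
Qed.

Section ExtensionNetwork.
Variables (R : realType) (N : network R) (M : R).
Hypothesis M_ge0 : (0 <= M)%R.
Let n := last_node N.
Let k := nb_trees N.
Let D := net_graph N.

Definition ext_node (v : 'I_n.+1) : 'I_n.+2 := widen_ord (leqnSn _) v.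

(** [W] lists the heads of the new arcs, once per parallel copy; [ord_max] is the added root. *)
Definition fresh_arcs (W : seq 'I_n.+1) : seq ('I_n.+2 * 'I_n.+2 * R) :=
  [seq (ord_max, ext_node v, M) | v <- W].

Definition old_arcs : seq ('I_n.+2 * 'I_n.+2 * R) :=
  [seq (ext_node (arc_tail a), ext_node (arc_head a), cost a) | a <- enum 'I_(arcs N)].

(** New arcs come first: the old part of an answer is what remains after dropping its first [size W]
    bits. *)
Definition ext_arcs W := fresh_arcs W ++ old_arcs.

Lemma ext_arcs_ge0 W (i : 'I_(size (ext_arcs W))) :
  (0 <= (tnth (in_tuple (ext_arcs W)) i).2)%R.
Proof.
have /= := mem_tnth i (in_tuple (ext_arcs W)); rewrite mem_cat => /orP[] /mapP[x _ ->] //=.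
exact: cost_ge0.
Qed.

Definition ext_network W : network R :=
  @Network R n.+1 (size (ext_arcs W))
    (fun i => (tnth (in_tuple (ext_arcs W)) i).1.1)
    (fun i => (tnth (in_tuple (ext_arcs W)) i).1.2)
    k (nb_trees_gt0 N) (fun i => (tnth (in_tuple (ext_arcs W)) i).2)
    (@ext_arcs_ge0 W).

Definition ext_rooted W : rooted_network R :=
  @RootedNetwork R (ext_network W) ord_max.

Lemma size_ext_arcs W : size (ext_arcs W) = size W + arcs N.
Proof. by rewrite size_cat 2!size_map size_enum_ord. Qed.

Lemma ext_arc_subproof W (a : 'I_(arcs N)) : size W + a < size (ext_arcs W).
Proof. by rewrite size_ext_arcs ltn_add2l. Qed.

Definition ext_arc W (a : 'I_(arcs N)) : 'I_(size (ext_arcs W)) :=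
  Ordinal (ext_arc_subproof W a).

Lemma tnth_ext_arc W a : tnth (in_tuple (ext_arcs W)) (ext_arc W a)
  = (ext_node (arc_tail a), ext_node (arc_head a), cost a).
Proof.
rewrite (tnth_nth (ord_max, ord_max, 0%R)) /= nth_cat /fresh_arcs size_map ltnNge
    leq_addr /=.
by rewrite addKn /old_arcs (nth_map a) ?size_enum_ord // nth_ord_enum.
Qed.

Lemma codom_ext_arc W (i : 'I_(size (ext_arcs W))) :
  (i \in codom (ext_arc W)) = (size W <= i).
Proof.
apply/codomP/idP => [[a ->]|le]; first exact: leq_addr.
have lt : i - size W < arcs N by rewrite ltn_subLR // -size_ext_arcs.
by exists (Ordinal lt); apply: val_inj; rewrite /= subnKC.
Qed.

Lemma tnth_fresh W (i : 'I_(size (ext_arcs W))) : i \notin codom (ext_arc W) ->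
  exists2 v, v \in W & tnth (in_tuple (ext_arcs W)) i = (ord_max, ext_node v, M).
Proof.
rewrite codom_ext_arc -ltnNge => lt.
rewrite (tnth_nth (ord_max, ord_max, 0%R)) /= nth_cat /fresh_arcs size_map lt.
by rewrite (nth_map ord0) //; exists (nth ord0 W i) => //; apply: mem_nth.
Qed.

Lemma ext_node_neq v : ext_node v != ord_max.
Proof. by rewrite neq_ltn /= ltn_ord. Qed.

Lemma ext_network_extension W : @root_extension D (net_graph (ext_network W))
  (ord_max : 'I_n.+2) ext_node (ext_arc W).
Proof.
split=> /=.
- move=> v' ne; have lt : v' < n.+1.
    by rewrite ltn_neqAle -ltnS ltn_ord andbT; apply: contraNneq ne => e; apply/eqP/val_inj.
  by exists (Ordinal lt); apply: val_inj.
- exact: ext_node_neq.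
- by move=> u v /(congr1 val) /= /val_inj.
- by move=> a b /(congr1 val) /= /addnI /val_inj.
- by move=> a; rewrite tnth_ext_arc.
- by move=> a; rewrite tnth_ext_arc.
by move=> i /tnth_fresh[v _ ->] /=; rewrite ext_node_neq.
Qed.

(** Edmonds' condition for the extension, written on [D]: a set of old nodes is entered by the new
    arcs with head in it and by its own cut. *)
Definition feasible (W : seq 'I_n.+1) : bool :=
  [forall X : {set 'I_n.+1}, (X != set0) ==>
    (k <= count (mem X) W + @cut D setT X)].

Lemma feasibleP W : reflect (forall X : {set 'I_n.+1}, X != set0 ->
    k <= count (mem X) W + @cut D setT X) (feasible W).
Proof. by apply: (iffP forallP) => h X; [apply/implyP/h|apply/implyP => /h]. Qed.

Lemma ext_cut W (X' : {set 'I_n.+2}) : ord_max \notin X' ->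
  @cut (net_graph (ext_network W)) setT X'
  = count (mem (ext_node @^-1: X')) W + @cut D setT (ext_node @^-1: X').
Proof.
move=> sX; pose P (t : 'I_n.+2 * 'I_n.+2 * R) := (t.1.2 \in X') && (t.1.1 \notin X').
transitivity (count P (ext_arcs W)).
  by rewrite -card_tnth_count; apply: eq_card => i; rewrite !inE.
rewrite count_cat 2!count_map; congr (_ + _).
  by apply: eq_count => v; rewrite /P /= sX andbT inE.
rewrite /cut -sum1_count big_enum_cond /= sum1dep_card.
by apply: eq_card => a; rewrite !inE /P /= /enters /= !inE.
Qed.

Lemma feasible_rootedP W : feasible W <->
  exists F, @rooted_k_arborescence (net_graph (ext_network W)) (ord_max : 'I_n.+2) k F.
Proof.
rewrite cut_rooted_k_arborescenceP; split=> [/feasibleP h X' sX X0|h].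
  rewrite ext_cut //; apply: h; case/set0Pn: X0 => v' vX.
  have [|v e] := phi_onto (ext_network_extension W) (v' := v').
    by apply: contraNneq sX => <-.
  by apply/set0Pn; exists v; rewrite inE -e.
apply/feasibleP => X /set0Pn[v vX].
have eX : ext_node @^-1: (ext_node @: X) = X.
  apply/setP => u; rewrite inE mem_imset //.
  exact: (phi_inj (ext_network_extension W)).
rewrite -eX -ext_cut; last first.
  by apply/imsetP=> -[u _ e]; have := ext_node_neq u; rewrite -e eqxx.
apply: h; last by apply/set0Pn; exists (ext_node v); apply: imset_f.
by apply/imsetP=> -[u _ e]; have := ext_node_neq u; rewrite -e eqxx.
Qed.

(** [None] never occurs: as [k] is positive, every rooted [k]-arborescence of the extension contains
    a new arc, so the set of all arcs is a transversal. *)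
Lemma ext_answer W (ans : option {set 'I_(size (ext_arcs W))}) :
  correct (blocking_rooted_k_arborescences R) (ext_rooted W) ans ->
  exists2 H, ans = Some H & (H != set0) = feasible W.
Proof.
rewrite /= => cor; have [/feasible_rootedP[F rF]|inf] := boolP (feasible W).
  have [F' optF] := min_cost_exists (@cost R (ext_network W)) rF.
  apply: transversal_answer_nonempty optF _ cor => F1 [rF1 _].
  have := fresh_lower_bound (ext_network_extension W) ord0 rF1.
  by apply: contraTneq => ->; rewrite set0D cards0 -ltnNge (nb_trees_gt0 N).
exists set0; last by rewrite eqxx.
apply: transversal_answer_empty cor => F [rF _].
by move/negP: inf; apply; apply/feasible_rootedP; exists F.
Qed.

(** [T] holds the new arcs not yet tested, [K] those kept. The [rev] mirrors the way the program
    builds its query; feasibility depends on multiplicities alone. *)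
Fixpoint greedy (T K : seq 'I_n.+1) : seq 'I_n.+1 :=
  if T is v :: T' then greedy T' (if feasible (rev T' ++ K) then K else v :: K)
  else K.

Lemma feasible_count W W' :
  (forall P : pred 'I_n.+1, count P W <= count P W') -> feasible W -> feasible W'.
Proof.
move=> le /feasibleP h; apply/feasibleP => X X0; apply: leq_trans (h X X0) _.
by rewrite leq_add2r.
Qed.

Lemma greedy_feasible T K : feasible (T ++ K) -> feasible (greedy T K).
Proof.
elim: T K => //= v T IH K fe; apply: IH; case: ifP => fe'.
  by apply: feasible_count fe' => P; rewrite !count_cat count_rev.
by apply: feasible_count fe => P; rewrite /= !count_cat /=; lia.
Qed.

(** When [v] has to be kept, the set violated without it contains [v] and is tight with it. Later
    deletions only lower counts, so the upper bound persists. *)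
Lemma greedy_tight T K :
  feasible (T ++ K) ->
  (forall v, v \in K -> exists2 X : {set 'I_n.+1}, v \in X &
     count (mem X) (T ++ K) + @cut D setT X <= k) ->
  forall v, v \in greedy T K -> exists2 X : {set 'I_n.+1}, v \in X &
     count (mem X) (greedy T K) + @cut D setT X <= k.
Proof.
elim: T K => //= u T IH K fe tK; apply: IH.
  case: ifP => fe'; first by apply: feasible_count fe' => P; rewrite !count_cat count_rev.
  by apply: feasible_count fe => P; rewrite /= !count_cat /=; lia.
case: ifP => fe' v.
  case/tK=> X vX h; exists X => //; apply: leq_trans h.
  by rewrite leq_add2r /= leq_addl.
rewrite inE => /orP[/eqP ->|]; last first.
  case/tK=> X vX h; exists X => //; apply: leq_trans h.
  by rewrite leq_add2r /= !count_cat /=; lia.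
move/negbT: fe'; rewrite negb_forall => /existsP[X];
    rewrite negb_imply -ltnNge => /andP[X0 lt].
have /feasibleP/(_ X X0) := fe; move: lt; rewrite /= !count_cat count_rev /= => lt ge.
exists X; last first.
  by rewrite count_cat /=; have := leq_b1 (mem X u); move: lt; clear; lia.
by apply: contraTT lt => /negPf uX; move: ge; rewrite uX -leqNgt add0n.
Qed.

(** The list that [tight_cover_size] compares with the survivors is that of the [k] roots of a
    packing in [D]; [packing_cut] supplies the condition required of it. *)
Lemma greedy_size T : 0 < n ->
  (forall v, (arcs N).*2 <= count_mem v T) ->
  (exists F, @k_arborescence D k F) -> size (greedy T [::]) <= k.
Proof.
move=> n0 many [F arbF].
have n2 : 1 < #|node D| by rewrite card_ord.
have [T' [r [arb dis eF]]] := (packing_root_choice k F (ord0 : node D)).1 arbF.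
have kA : k <= arcs N.
    by apply: leq_trans (k_arborescence_card n2 arbF) _; rewrite -[arcs N]card_ord max_card.
have fe : feasible T.
  apply/feasibleP => X /set0Pn[v vX]; apply: leq_trans (leq_addr _ _).
  apply: leq_trans kA _; apply: (@leq_trans (count_mem v T)).
    by apply: leq_trans (many v); rewrite -addnn leq_addr.
  by apply: sub_count => u /eqP ->.
have szr : size (codom r) = k by rewrite size_codom card_ord.
rewrite -szr; apply: (@tight_cover_size _ _ _ (@cut D setT) k).
- exact: cut_submod.
- by apply/feasibleP/greedy_feasible; rewrite cats0.
- by apply: greedy_tight; rewrite ?cats0.
move=> X X0; apply: leq_trans (packing_cut arb dis X0) _.
apply: leq_add.
  by rewrite /codom /image_mem count_map -sum1_count big_enum_cond sum1dep_card.
by apply/subset_leq_card/subsetP => a; rewrite !inE => /andP[].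
Qed.

Lemma feasible_k_arborescence W : feasible W -> size W <= k ->
  exists F, @k_arborescence D k F.
Proof.
move=> /feasible_rootedP[F rF] le; exists (ext_arc W @^-1: F).
apply: (restrict_packing (ext_network_extension W) ord0 rF).
apply: leq_trans le; have <- : #|~: (ext_arc W @: setT)| = size W.
  have inj := psi_inj (ext_network_extension W).
  apply/eqP; rewrite -(eqn_add2l #|ext_arc W @: setT|) cardsC card_ord.
  by rewrite card_imset // cardsT card_ord size_ext_arcs addnC.
by apply/subset_leq_card/subsetP => a; rewrite !inE => /andP[].
Qed.

Lemma fresh_multiplicity W v : count_mem v W <=
  #|[set a' | (a' \notin codom (ext_arc W)) &&
      (dhead (d := net_graph (ext_network W)) a' == ext_node v)]|.
Proof.
pose P (t : 'I_n.+2 * 'I_n.+2 * R) := (t.1.1 == ord_max) && (t.1.2 == ext_node v).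
rewrite (_ : #|_| = count P (ext_arcs W)).
  rewrite count_cat count_map; apply: leq_trans (leq_addr _ _).
  by apply: sub_count => u /eqP ->; rewrite /P /= !eqxx.
rewrite -card_tnth_count; apply: eq_card => i.
by rewrite !inE (fresh_tail (ext_network_extension W)).
Qed.

Lemma reduction_answer T (ans : option {set 'I_(size (ext_arcs (rev T)))}) :
  (\sum_(a : 'I_(arcs N)) cost a < M)%R -> 0 < n ->
  (forall v, (arcs N).*2 <= count_mem v T) ->
  correct (blocking_rooted_k_arborescences R) (ext_rooted (rev T)) ans ->
  exists2 H, ans = Some H &
    correct (blocking_k_arborescences R) N
      (Some (if size (greedy T [::]) <= k then ext_arc (rev T) @^-1: H else set0)).
Proof.
move=> bigM n0 many cor; have [H eH feH] := ext_answer cor; exists H => //.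
have [exF|noF] := EM (exists F, @k_arborescence D k F).
  rewrite greedy_size //.
  have extn := ext_network_extension (rev T).
  have [a|a|i fr||v|H1] := extension_answer extn (c := @cost R N)
    (c' := @cost R (ext_network (rev T))) _ _ _ bigM _ (nb_trees_gt0 N) _ exF cor.
  - exact: cost_ge0.
  - by rewrite /= tnth_ext_arc.
  - by have [v _ /= ->] := tnth_fresh fr.
  - by rewrite card_ord.
  - apply: leq_trans (fresh_multiplicity (rev T) v).
    by rewrite card_ord count_rev.
  by rewrite eH => -[<-].
(* Few survivors alone prove nothing: from an infeasible list nothing is deleted, and [k] may exceed
   the number of all new arcs. But in that case the oracle has returned the empty set, whose
   preimage is the right answer here. *)
have -> : (if size (greedy T [::]) <= k then ext_arc (rev T) @^-1: H else set0) = set0.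
  case: ifP => // le; have inf : ~~ feasible (rev T).
    apply/negP => fe; apply: noF; apply: feasible_k_arborescence le.
    by apply: greedy_feasible; apply: feasible_count fe => P; rewrite cats0 count_rev.
  by move: inf; rewrite -feH negbK => /eqP ->; apply/setP => a; rewrite !inE.
by split=> [F [arbF _]|H' _]; [case: noF; exists F|rewrite cards0].
Qed.

End ExtensionNetwork.

(** * Running programs *)

Definition sto (R : Type) (l : seq (data R)) : store R := nth DNil l.

Lemma update_sto (R : Type) (l : seq (data R)) x d :
  update (sto l) x d = sto (set_nth DNil l x d).
Proof. by apply/funext => y; rewrite /update /sto nth_set_nth. Qed.

Fixpoint loopfree (p : cmd) : bool :=
  match p with
  | CAssign _ _ => true
  | CSeq p q => loopfree p && loopfree q
  | CIf _ p q => loopfree p && loopfree q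
  | _ => false
  end.

(** Executes straight-line code by computation on a list of registers; the value at loops and
    queries is a dummy that [loopfree] excludes. *)
Fixpoint run (R : realType) (p : cmd) (l : seq (data R)) : seq (data R) * nat :=
  match p with
  | CAssign x e =>
      (set_nth DNil l x (eval (sto l) e), (dsize (eval (sto l) e)).+1)
  | CSeq p q =>
      let r1 := run p l in let r2 := run q r1.1 in (r2.1, (r1.2 + r2.2).+1)
  | CIf e p q =>
      let r := if dtrue (eval (sto l) e) then run p l else run q l in (r.1, r.2.+1)
  | _ => (l, 0)
  end.

Definition exec_le (R : realType) (O : data R -> data R) (p : cmd)
    (l : seq (data R)) (B : nat) (l' : seq (data R)) : Prop :=
  exists2 t, exec O p (sto l) t (sto l') & t <= B.

Section ExecRules.
Variables (R : realType) (O : data R -> data R).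
Implicit Types (p q : cmd) (l : seq (data R)).

Lemma run_exec p l : loopfree p -> exec O p (sto l) (run p l).2 (sto (run p l).1).
Proof.
elim: p l => //= [x e|p IHp q IHq|e p IHp q IHq] l.
- by rewrite -update_sto => _; apply: ExecAssign.
- by case/andP=> /IHp h1 /IHq h2; apply: ExecSeq (h1 _) (h2 _).
case/andP=> /IHp h1 /IHq h2; case: ifP => c; first exact: ExecIfTrue.
by apply: ExecIfFalse; rewrite ?c.
Qed.

Lemma exec_run p l l' B : loopfree p -> (run p l).1 = l' -> (run p l).2 <= B ->
  exec_le O p l B l'.
Proof. by move=> lf <- le; exists (run p l).2 => //; apply: run_exec. Qed.

Lemma exec_seq p q l l1 l2 B1 B2 B :
  exec_le O p l B1 l1 -> exec_le O q l1 B2 l2 -> B1 + B2 < B ->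
  exec_le O (CSeq p q) l B l2.
Proof.
move=> [t1 e1 le1] [t2 e2 le2] lt; exists (t1 + t2).+1; first exact: ExecSeq e1 e2.
by apply: leq_ltn_trans lt; apply: leq_add.
Qed.

Lemma exec_if e p q l l' B :
  (if dtrue (eval (sto l) e) then exec_le O p l B l' else exec_le O q l B l') ->
  exec_le O (CIf e p q) l B.+1 l'.
Proof.
case: ifP => c [t ex le]; exists t.+1 => //; first exact: ExecIfTrue.
by apply: ExecIfFalse; rewrite ?c.
Qed.

Lemma exec_query x e l :
  exec_le O (CQuery x e) l (dsize (eval (sto l) e) + dsize (O (eval (sto l) e))).+1
    (set_nth DNil l x (O (eval (sto l) e))).
Proof. by eexists; [rewrite -update_sto; apply: ExecQuery|]. Qed.

(* S a xs is the store when the accumulated value is a and the elements xs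
   remain to be read. *)
Lemma exec_for (X A : Type) (S : A -> seq X -> seq (data R)) (g : A -> X -> A)
    (Inv : A -> seq X -> Prop) e p c :
  (forall a x xs, dtrue (eval (sto (S a (x :: xs))) e)) ->
  (forall a, ~~ dtrue (eval (sto (S a [::])) e)) ->
  (forall a x xs, Inv a (x :: xs) ->
     Inv (g a x) xs /\ exec_le O p (S a (x :: xs)) c (S (g a x) xs)) ->
  forall xs a, Inv a xs ->
  exec_le O (CWhile e p) (S a xs) (size xs * c.+1).+1 (S (foldl g a xs) [::]).
Proof.
move=> ct cf body; elim=> [|x xs IH] a inv.
  by exists 1 => //; apply: ExecWhileFalse.
have [inv' [t1 e1 le1]] := body _ _ _ inv; have [t2 e2 le2] := IH _ inv'.
exists (t1 + t2).+1; first exact: ExecWhileTrue (ct _ _ _) e1 e2.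
by rewrite /= ltnS mulSn addSn -addnS leq_add.
Qed.

End ExecRules.
Arguments exec_run {R O p l l' B}.
Arguments exec_seq {R O p q l l1 l2 B1 B2 B}.
Arguments exec_for {R O X A S g Inv e p c}.

(** * Sizes of encodings *)

Section DataSize.
Variable R : realType.
Implicit Types (l : seq (data R)).

Lemma dsize_gt0 (d : data R) : 0 < dsize d.
Proof. by case: d. Qed.

Lemma dsize_dlist l : dsize (dlist l) = (\sum_(d <- l) (dsize d).+1).+1.
Proof.
elim: l => [|d l IH] /=; first by rewrite big_nil.
by rewrite big_cons IH; lia.
Qed.

Lemma size_dlist l : size l <= dsize (dlist l).
Proof. by elim: l => //= d l IH; lia. Qed.

Lemma dsize_dlist_cat l1 l2 :
  dsize (dlist (l1 ++ l2)) + 1 = dsize (dlist l1) + dsize (dlist l2).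
Proof. by rewrite !dsize_dlist big_cat /=; lia. Qed.

Lemma dsize_dlist_catrev l1 l2 :
  dsize (dlist (catrev l1 l2)) + 1 = dsize (dlist l1) + dsize (dlist l2).
Proof. by elim: l1 l2 => [|d l1 IH] l2 /=; [lia|rewrite IH /=; lia]. Qed.

Lemma dsize_dunary n : dsize (dunary R n) = n.*2.+1.
Proof. by elim: n => //= n; rewrite /dunary /= => ->. Qed.

End DataSize.

Section Updates.
Variables (R : realType) (O : data R -> data R).
Implicit Types (l : seq (data R)).

Lemma sto_set_id l x d : sto l x = d -> sto (set_nth DNil l x d) = sto l.
Proof. by move=> <-; apply/funext => z; rewrite /sto nth_set_nth /=;
    case: eqP => // ->. Qed.

Lemma sto_set l x d z : sto (set_nth DNil l x d) z = if z == x then d else sto l z.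
Proof. by rewrite /sto nth_set_nth. Qed.

Lemma exec_assign x e l v : eval (sto l) e = v ->
  exec_le O (CAssign x e) l (dsize v).+1 (set_nth DNil l x v).
Proof. by move=> <-; eexists; [rewrite -update_sto; apply: ExecAssign|]. Qed.

(** Lists that differ by trailing [DNil] or by idle writes are the same store, so they are compared
    through [sto]. *)
Lemma exec_le_eq p l1 l1' l2 l2' B B' : sto l1 = sto l1' -> sto l2 = sto l2' ->
  B <= B' -> exec_le O p l1 B l2 -> exec_le O p l1' B' l2'.
Proof. by rewrite /exec_le => -> -> le [t ex le']; exists t => //; apply: leq_trans le. Qed.

End Updates.
Arguments exec_le_eq {R O p l1 l1' l2 l2' B B'}.

Definition copy_rev (x y : nat) : cmd :=
  CWhile (EVar x)
    (CSeq (CAssign y (ECons (EHd (EVar x)) (EVar y))) (CAssign x (ETl (EVar x)))).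

(** At the end [y] is empty exactly when the numbers were equal: if [y] runs out first, it is set to
    1 and [x] is cleared, which ends the loop. *)
Definition unary_compare (x y : nat) : cmd :=
  CWhile (EVar x)
    (CIf (EVar y)
      (CSeq (CAssign x (ETl (EVar x))) (CAssign y (ETl (EVar y))))
      (CSeq (CAssign x ENil) (CAssign y (ECons ENil ENil)))).


Section Macros.
Variables (R : realType) (O : data R -> data R).
Implicit Types (l : seq (data R)).

Lemma exec_copy_rev x y l xs acc w : x != y ->
  sto l x = dlist xs -> sto l y = dlist acc ->
  dsize (dlist xs) + dsize (dlist acc) <= w ->
  exec_le O (copy_rev x y) l (size xs * (w.*2 + 6)).+1
    (set_nth DNil (set_nth DNil l y (dlist (catrev xs acc))) x DNil).
Proof.
move=> xy ex ey le.
pose S a xs := set_nth DNil (set_nth DNil l y (dlist a)) x (dlist xs : data R).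
have Sx a zs : sto (S a zs) x = dlist zs by rewrite sto_set eqxx.
have Sy a zs : sto (S a zs) y = dlist a by rewrite sto_set eq_sym (negPf xy) sto_set eqxx.
have -> : dlist (catrev xs acc) = dlist (foldl (fun a d => d :: a) acc xs).
  by congr dlist; elim: xs acc {ex ey le} => //= d xs IH acc.
apply: (@exec_le_eq _ _ _ (S acc xs) _ (S (foldl (fun a d => d :: a) acc xs) [::])
  _ (size xs * (w.*2 + 5).+1).+1); rewrite ?addnS //.
  by rewrite /S sto_set_id ?sto_set_id.
apply: (exec_for (Inv := fun a zs => dsize (dlist zs) + dsize (dlist a) <= w)) le.
- by move=> a d zs; rewrite /= Sx.
- by move=> a; rewrite /= Sx.
move=> a d zs inv; split; first by move: inv => /=; lia.
apply: (exec_le_eq (erefl _) _ (leqnn _)); last first.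
  apply: exec_seq; [apply: exec_assign; rewrite /= Sx Sy; reflexivity| |].
    by apply: exec_assign; rewrite /= sto_set (negPf xy) Sx; reflexivity.
  by move: inv => /=; lia.
apply/funext => z; rewrite /S !sto_set; do 2 case: eqP => //.
Qed.

Lemma exec_unary_compare x y l u v z : x != y ->
  sto l x = dunary R u -> sto l y = dunary R v -> u <= z -> v <= z ->
  exec_le O (unary_compare x y) l (u * (4 * z + 20)).+1
    (set_nth DNil (set_nth DNil l y (dunary R (if u <= v then v - u else 1))) x DNil).
Proof.
move=> xy; elim: u v l => [|u IH] v l ex ey leu lev.
  exists 1 => //; rewrite subn0; set l' := set_nth _ _ _ _.
  have -> : sto l' = sto l.
    by rewrite /l' sto_set_id ?sto_set_id.
  by apply: ExecWhileFalse; rewrite /= ex.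
(* The store after one iteration; [v = 0] is the case in which [y] has run out. *)
pose l1 := set_nth DNil (set_nth DNil l x (dunary R (if v is _.+1 then u else 0)))
  y (dunary R (if v is v'.+1 then v' else 1)).
have l1x : sto l1 x = dunary R (if v is _.+1 then u else 0).
  by rewrite !sto_set (negPf xy) eqxx.
have l1y : sto l1 y = dunary R (if v is v'.+1 then v' else 1) by rewrite !sto_set eqxx.
have [t2 ex2 le2] : exec_le O (unary_compare x y) l1 (u * (4 * z + 20)).+1
    (set_nth DNil (set_nth DNil l y (dunary R (if u < v then v - u.+1 else 1))) x DNil).
  case: v lev {ey} @l1 l1x l1y => [|v] lev l1 l1x l1y.
    exists 1 => //; set l' := set_nth _ _ _ _; suff -> : sto l' = sto l1.
      by apply: ExecWhileFalse; rewrite /= l1x.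
    by apply/funext => q; rewrite /l' /l1 !sto_set; case: eqP => [->|//];
        rewrite (negPf xy).
  apply: exec_le_eq (IH _ _ l1x l1y (ltnW leu) (ltnW lev)) => //.
  by apply/funext => q; rewrite /l1 ltnS subSS !sto_set; case: (q == x) => //;
      case: (q == y).
have [t1 ex1 le1] : exec_le O (CIf (EVar y)
      (CSeq (CAssign x (ETl (EVar x))) (CAssign y (ETl (EVar y))))
      (CSeq (CAssign x ENil) (CAssign y (ECons ENil ENil)))) l (4 * z + 15) l1.
  rewrite -addn1 -[15]/(14 + 1) addnA !addn1; apply: exec_if; rewrite /= ey.
  case: v lev {IH l1x l1y ex2 le2} @l1 ey => [|v] lev l1 ey /=.
    apply: exec_seq; [by apply: exec_assign|by apply: exec_assign|].
    by rewrite /=; lia.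
  apply: exec_seq; [by apply: exec_assign; rewrite /= ex| |].
    by apply: exec_assign; rewrite /= sto_set eq_sym (negPf xy) ey; reflexivity.
  by rewrite -/(dunary R u) -/(dunary R v) !dsize_dunary; lia.
exists (t1 + t2).+1; last by rewrite mulSn; move: le1 le2; clear; lia.
by apply: ExecWhileTrue ex1 ex2; rewrite /= ex.
Qed.

End Macros.

(** * From rooted to unrooted *)

Arguments dlist : simpl never.
Arguments dunary : simpl never.

Lemma monomial_bound c d : exists b : {poly nat}, forall z, (b.[z])%R = c * z ^ d.
Proof.
exists (c%:P * 'X^d)%R => z; rewrite hornerM hornerC hornerXn.
by congr (_ * _); elim: d => //= d IH; rewrite exprS IH expnS.
Qed.

Lemma dsize_enc_arc_set (R : realType) m (ans : option {set 'I_m}) :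
  dsize (enc_arc_set R ans) <= 4 * m + 3.
Proof.
case: ans => [H|] /=; last by lia.
rewrite dsize_dlist big_map.
have : \sum_(a <- enum 'I_m) (dsize (dbool R (a \in H))).+1 <= \sum_(a <- enum 'I_m) 4.
  by apply: leq_sum => a _; case: (a \in H).
by rewrite big_const_seq count_predT size_enum_ord iter_addn_0 /=; lia.
Qed.

Section LoopsAtSource.
Variables (R : realType) (N : rooted_network R).
Let m := arcs N.
Let s := source N.

Definition loop_tail (a : 'I_m) : 'I_(last_node N).+1 :=
  if arc_head a == s then s else arc_tail a.

Definition loop_network : network R :=
  @Network R (last_node N) m loop_tail (@arc_head R N) (nb_trees N) (nb_trees_gt0 N)
    (@cost R N) (@cost_ge0 R N).

(** A set avoiding [s] is entered only by arcs whose head is not [s], and these keep their tails;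
    in-degrees depend on heads alone. *)
Lemma loop_rooted_arb (F : {set 'I_m}) :
  @rooted_arb (net_graph loop_network) F s <-> @rooted_arb (net_graph N) F s.
Proof.
have e (X : {set 'I_(last_node N).+1}) a : s \notin X ->
    @enters (net_graph loop_network) X a = @enters (net_graph N) X a.
  move=> sX; rewrite /enters /= /loop_tail; case: eqP => [->|//].
  by rewrite (negPf sX).
split=> -[deg ent]; split=> // X sX X0; have [a aF en] := ent X sX X0; exists a => //.
  by rewrite -e.
by rewrite e.
Qed.

Lemma loop_k_arborescence :
  @k_arborescence (net_graph loop_network) (nb_trees N)
  = @rooted_k_arborescence (net_graph N) s (nb_trees N).
Proof.
apply/funext => F; apply/propext; rewrite packing_rooted_arbP; split.
  case=> T [arb dis eF]; exists T; split=> // i; apply/loop_rooted_arb/root_rooted_arb.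
    exact: arb.
  apply/eqP; rewrite -leqn0 leqNgt; apply/negP => /indeg_gt0P[a aT /= ha].
  have [tree _] := arb i; have := spanning_tree_no_loop tree aT.
  by rewrite /= /loop_tail ha !eqxx.
case=> T [arb dis eF]; exists T; split=> // i.
by have /loop_rooted_arb/rooted_arbP[] := arb i.
Qed.

End LoopsAtSource.

(** Registers: 0 input and answer, 1 the source, 2 the rewritten arcs, 3 the arcs still to be read,
    4 the current arc, 5 and 6 the comparison of its head with the source. If they agree, the head,
    being the source, replaces the tail. *)
Definition loop_body : cmd :=
  CSeq (CSeq (CAssign 4 (EHd (EVar 3))) (CSeq (CAssign 3 (ETl (EVar 3)))
       (CSeq (CAssign 5 (EHd (ETl (EVar 4)))) (CAssign 6 (EVar 1)))))
  (CSeq (unary_compare 5 6)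
    (CSeq (CIf (EVar 6) (CAssign 6 ENil)
             (CAssign 4 (ECons (EHd (ETl (EVar 4))) (ETl (EVar 4)))))
      (CSeq (CAssign 2 (ECons (EVar 4) (EVar 2))) (CAssign 4 ENil)))).

(** The arcs are reversed before being pushed one by one, which restores their order; the bits of
    the oracle then answer the original instance as they stand. *)
Definition loop_program : cmd :=
  CSeq (CSeq (CAssign 1 (EHd (EVar 0))) (CAssign 2 (EHd (ETl (ETl (EVar 0))))))
  (CSeq (copy_rev 2 3)
  (CSeq (CWhile (EVar 3) loop_body)
    (CQuery 0 (ECons (EHd (ETl (EVar 0))) (ECons (EVar 2) (ETl (ETl (ETl (EVar 0))))))))).

Section Encoding.
Variable R : realType.
Implicit Types (l : seq (data R)).

Lemma dsize_dlist_cons (d : data R) l :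
  dsize (dlist (d :: l)) = (dsize d + dsize (dlist l)).+1.
Proof. by []. Qed.

Lemma dsize_dlist_map_le (T : Type) (f : T -> data R) b (ts : seq T) :
  (forall t, dsize (f t) <= b) -> dsize (dlist (map f ts)) <= size ts * b.+1 + 1.
Proof.
move=> le; elim: ts => [|t ts IH]; first by rewrite addn1.
rewrite [map _ _]/= dsize_dlist_cons [size _]/= mulSn.
have := le t; move: IH; move: (dsize _) (dsize _) (_ * _) => q1 q2 q3; clear; lia.
Qed.

Definition enc_arc (t h : nat) (c : R) : data R :=
  DCons (dunary R t) (DCons (dunary R h) (DCons (DReal c) DNil)).

Lemma enc_networkE (N' : network R) : enc_network N' =
  DCons (dunary R (last_node N').+1)
    (DCons (dlist [seq enc_arc (arc_tail a) (arc_head a) (cost a) | a <- enum 'I_(arcs N')])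
      (DCons (dbinary R (nb_trees N')) DNil)).
Proof. by []. Qed.

Lemma dsize_enc_arc t h c : dsize (enc_arc t h c) = t.*2 + h.*2 + 7.
Proof. by rewrite /enc_arc /= !dsize_dunary; lia. Qed.

End Encoding.

Section LoopProgram.
Variables (R : realType) (O : data R -> data R) (N : rooted_network R).
Let s := source N.
Let z := dsize (enc_rooted_network N).

Lemma exec_loop_body d0 (a : 'I_(arcs N)) xs acc :
  last_node N < z -> dsize (dlist xs) <= z ->
  exec_le O loop_body
    [:: d0; dunary R s; dlist acc; DCons (enc_arc (arc_tail a) (arc_head a) (cost a))
        (dlist xs);
      DNil; DNil; DNil]
    (dsize (dlist acc) + 300 * (z * z))
    [:: d0; dunary R s; DCons (enc_arc (loop_tail a) (arc_head a) (cost a)) (dlist acc);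
      dlist xs; DNil; DNil; DNil].
Proof.
move=> nz xsz; have hz := ltn_ord (arc_head a); have tz := ltn_ord (arc_tail a).
have sz := ltn_ord s; rewrite /enc_arc.
have hq : dtrue (dunary R (if arc_head a <= s then s - arc_head a else 1)) = (arc_head a
    != s).
  rewrite -(inj_eq val_inj) /=; case: leqP => [le|gt]; last by rewrite gtn_eqF.
  by rewrite eq_sym eqn_leq le andbT -subn_eq0; case: (s - arc_head a).
apply: (exec_seq (B1 := 100 + 10 * z)); [apply: exec_run; [by []|reflexivity|]| |].
- by rewrite /= !dsize_dunary; move: hz tz sz nz xsz; clear; lia.
- rewrite /=; apply: exec_seq.
  + by apply: (@exec_unary_compare _ _ 5 6 _ (arc_head a) s z) => //; lia.
  + apply: (exec_run (B := dsize (dlist acc) + 100 + 10 * z)) => //=;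
      rewrite hq /loop_tail -/s.
      by case: eqP => [->|] /=; rewrite ?leqnn ?subnn.
    case: eqP => _ /=; rewrite !dsize_dunary; move: hz tz sz nz xsz; clear; lia.
  exact: leqnn.
have : arc_head a * (4 * z + 20) <= z * (4 * z + 20).
  by rewrite leq_mul2r; apply/orP; right; lia.
have : z <= z * z by rewrite leq_pmulr //; lia.
move: (z) (arc_head a * _) (dsize _) nz => y q w; clear; lia.
Qed.

Definition loop_input := dlist [seq enc_arc (arc_tail a) (arc_head a) (cost a) | a <-
    enum 'I_(arcs N)].

Lemma loop_input_sizes : [/\ last_node N < z, arcs N <= z, dsize loop_input <= z
  & dsize (dbinary R (nb_trees N)) <= z].
Proof.
have := size_dlist [seq enc_arc (arc_tail a) (arc_head a) (cost a) | a <- enum 'I_(arcs N)].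
rewrite size_map size_enum_ord -/loop_input /z /enc_rooted_network enc_networkE
    -/loop_input /=.
by rewrite !dsize_dunary => ?; split; lia.
Qed.

Lemma exec_loop_program ans :
  O (enc_network (loop_network N)) = enc_arc_set R ans ->
  exists l : seq (data R), sto l 0 = enc_arc_set R (ans : option {set 'I_(arcs N)}) /\
  exec_le O loop_program [:: enc_rooted_network N] (1000 * z ^ 3) l.
Proof.
move=> Oans; have [nz mz iz kz] := loop_input_sizes.
pose enc (a : 'I_(arcs N)) : data R := enc_arc (arc_tail a) (arc_head a) (cost a).
pose xs := map enc (enum 'I_(arcs N)).
pose enc' (a : 'I_(arcs N)) : data R := enc_arc (loop_tail a) (arc_head a) (cost a).
(* A rewritten arc may be longer than the original, as [s] can have a larger index than the old
   tail; so the output is bounded arc by arc, not by the input. *)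
have le' a : dsize (enc' a) <= 4 * z + 3.
  by rewrite dsize_enc_arc; have := ltn_ord (loop_tail a); have := ltn_ord (arc_head a);
      lia.
pose d0 := enc_rooted_network N.
pose kb := dbinary R (nb_trees N).
pose S (acc : seq (data R)) (as_ : seq 'I_(arcs N)) := [:: d0; dunary R s; dlist acc;
   dlist (map enc as_); DNil; DNil; DNil].
pose fin := [:: enc_arc_set R ans; dunary R s; dlist (map enc' (enum 'I_(arcs N))); DNil;
    DNil; DNil; DNil].
exists fin; split=> //; rewrite /enc_rooted_network enc_networkE -/xs.
have sz := ltn_ord s; change (is_true (dsize (dlist xs) <= z)) in iz.
apply: exec_seq.
- apply: (exec_run (B := 100 + 10 * z) (l' := [:: d0; dunary R s; dlist xs])) => //=.
  by rewrite -/s -/xs dsize_dunary; move: (dsize _) iz nz sz => q; clear; lia.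
- apply: exec_seq.
  + by apply: (@exec_copy_rev _ _ 2 3 _ xs [::] z.+1) => //; rewrite /=; move: iz; clear;
      lia.
  + apply: (exec_seq (l1 := S (map enc' (enum 'I_(arcs N))) [::])).
    * have -> : map enc' (enum 'I_(arcs N)) = foldl (fun acc a => enc' a :: acc) [::]
        (rev (enum 'I_(arcs N))).
        by rewrite foldl_rev.
      apply: (exec_le_eq (l1 := S [::] (rev (enum 'I_(arcs N))))) (leqnn _) _ => //.
        rewrite -[catrev xs [::]]/(rev xs) /xs
          -(map_rev enc).
        by apply/funext; do 8 case=> //.
      (* A push is charged for the whole list, whose size may be quadratic in [z]; with at most [z]
         arcs the loop is cubic. *)
      apply: (exec_for (c := z * (4 * z + 4) + 1 + 300 * (z * z))
         (Inv := fun acc (as_ : seq 'I_(arcs N)) => dsize (dlist acc) + size as_ * (4 * z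
             + 4) <= z * (4 * z + 4) + 1
          /\ dsize (dlist (map enc as_)) <= z)).
      - by [].
      - by [].
      - move=> acc a as_ [inv1 inv2].
        have inv2' : dsize (dlist (map enc as_)) <= z.
          by move: inv2; rewrite [map _ _]/= dsize_dlist_cons;
              move: (dsize (dlist _)) => q; clear; lia.
        split.
          split=> //; move: inv1; rewrite [size _]/= mulSn dsize_dlist_cons; have := le' a.
          by move: (dsize (enc' a)) (dsize _) (size as_ * _) => q1 q2 q3; clear; lia.
        apply: (exec_le_eq _ _ _ (exec_loop_body d0 a acc nz inv2')) => //.
        rewrite leq_add2r; apply: leq_trans inv1; exact: leq_addr.
      split; last first.
        have -> : map enc (rev (enum 'I_(arcs N))) = catrev xs [::] by rewrite map_rev.
        by have := dsize_dlist_catrev xs [::]; move: (dsize _) (dsize _) iz => q1 q2;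
            rewrite /=; clear; lia.
      by rewrite size_rev size_enum_ord [dsize _]/= addnC leq_add2r leq_mul2r mz orbT.
    * rewrite /S; apply: (exec_le_eq _ _ (leqnn _) (exec_query _ _ _ _)) => //.
      rewrite /= -/enc' -[DCons _ _]/(enc_network (loop_network N)) Oans.
      by apply/funext; do 8 case=> //.
    * exact: leqnn.
  + exact: leqnn.
- rewrite -[eval _ _]/(enc_network (loop_network N)) Oans size_rev size_map size_enum_ord.
  have ansz := dsize_enc_arc_set R ans.
  have qz : dsize (enc_network (loop_network N)) <= 2 * z + (z * (4 * z + 4) + 1) + z + 10.
    have -> : dsize (enc_network (loop_network N)) = (dsize (dunary R (last_node N).+1) +
      (dsize (dlist (map enc' (enum 'I_(arcs N)))) + (dsize kb + 1).+1).+1).+1 by [].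
    have := dsize_dlist_map_le (enum 'I_(arcs N)) le'; rewrite size_enum_ord dsize_dunary.
    have : arcs N * (4 * z + 3).+1 <= z * (4 * z + 4) by rewrite [4 * z + 4]addnS leq_mul.
    move: kz nz; rewrite -/kb; move: (last_node N) (z) (z * _) (arcs N * _) (dsize (dlist
        _)) (dsize kb) => n y q4 q3 q2 q1.
    by clear; lia.
  have h1 : arcs N * (z.+1.*2 + 6) <= z * (z.+1.*2 + 6) by rewrite leq_mul2r mz orbT.
  have h2 : arcs N * (z * (4 * z + 4) + 1 + 300 * (z * z)).+1 <=
      z * (z * (4 * z + 4) + 1 + 300 * (z * z)).+1 by rewrite leq_mul2r mz orbT.
  have z0 : 0 < z by apply: leq_trans nz.
  have h3 : z <= z * z by rewrite leq_pmulr.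
  have h4 : z * z <= z * z * z by rewrite leq_pmulr.
  rewrite !expnS expn0 muln1; move: ansz qz h1 h2 h3 h4 mz z0.
  move: (z) (arcs N) (arcs N * (z.+1.*2 + 6))
    (arcs N * (z * (4 * z + 4) + 1 + 300 * (z * z)).+1) (dsize (enc_network _)) (dsize
        (enc_arc_set _ _)) => y m q4 q3 q2 q1.
  by clear; lia.
Qed.

End LoopProgram.

Lemma rooted_reducible (R : realType) :
  poly_time_reducible (blocking_rooted_k_arborescences R) (blocking_k_arborescences R).
Proof.
have [b hb] := monomial_bound 1000 3.
exists loop_program, b => O sol N.
have [ans cor eO] := sol (loop_network N).
have [l [l0 [t ex le]]] := exec_loop_program eO.
exists t, (sto l), ans; split=> //.
- suff -> : init_store (enc_instance N) = sto [:: enc_rooted_network N] by [].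
  by apply/funext; do 2 case=> //.
- by rewrite hb.
by move: cor; rewrite /= loop_k_arborescence.
Qed.

(** * From unrooted to rooted *)

(* Registers: 0 input and output, 1 the number of nodes (which also encodes the
   new root), 2 the arcs, 3 the binary number of trees, 4 the cost of a new arc,
   5 the new arcs still to be tested, 6 the new arcs kept followed by the old
   arcs, 7 the number of new arcs kept, 10 the candidate answer, 14 the number
   of trees as a real; the others are scratch. *)
Definition sum_costs : cmd :=
  CSeq (CSeq (CAssign 4 EOne) (CAssign 8 (EVar 2)))
    (CWhile (EVar 8)
      (CSeq (CAssign 4 (EAdd (EVar 4) (EHd (ETl (ETl (EHd (EVar 8)))))))
         (CAssign 8 (ETl (EVar 8))))).

(** Two pushes per old arc give the multiplicity 2|A|. Register 8 counts the nodes down and, in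
    unary, is itself the code of the head. *)
Definition make_fresh : cmd :=
  CSeq (CAssign 8 (EVar 1))
    (CWhile (EVar 8)
      (CSeq (CSeq (CAssign 8 (ETl (EVar 8))) (CAssign 9 (EVar 2)))
        (CWhile (EVar 9)
          (CSeq (CAssign 11 (ECons (EVar 1) (ECons (EVar 8) (ECons (EVar 4) ENil))))
          (CSeq (CAssign 5 (ECons (EVar 11) (ECons (EVar 11) (EVar 5))))
          (CSeq (CAssign 11 ENil) (CAssign 9 (ETl (EVar 9))))))))).

Definition ask : cmd :=
  CSeq (CSeq (CAssign 8 (EVar 5)) (CAssign 9 (EVar 6)))
  (CSeq (copy_rev 8 9)
  (CSeq (CQuery 12 (ECons (EVar 1) (ECons (ECons ENil (EVar 1))
                      (ECons (EVar 9) (ECons (EVar 3) ENil)))))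
    (CAssign 9 ENil))).

(** Saves the answer to the first query, in which all new arcs are present, dropping one bit for
    each of them. *)
Definition keep_candidate : cmd :=
  CSeq (CSeq (CAssign 8 (EVar 5)) (CSeq (CAssign 10 (ETl (EVar 12))) (CAssign 12 ENil)))
    (CWhile (EVar 8) (CSeq (CAssign 10 (ETl (EVar 10))) (CAssign 8 (ETl (EVar 8))))).

(** The first [ETl] removes the tag of [Some]; [CAssign 8 ENil] stands for an idle command, register
    8 being empty at this point. *)
Definition scan_answer : cmd :=
  CSeq (CAssign 12 (ETl (EVar 12)))
    (CWhile (EVar 12)
      (CSeq (CIf (EHd (EVar 12)) (CAssign 13 (EHd (EVar 12))) (CAssign 8 ENil))
        (CAssign 12 (ETl (EVar 12))))).

Definition greedy_loop : cmd :=
  CWhile (EVar 5)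
    (CSeq (CSeq (CAssign 11 (EHd (EVar 5))) (CAssign 5 (ETl (EVar 5))))
    (CSeq ask
    (CSeq scan_answer
    (CIf (EVar 13)
      (CSeq (CAssign 11 ENil) (CAssign 13 ENil))
      (CSeq (CAssign 6 (ECons (EVar 11) (EVar 6)))
        (CSeq (CAssign 7 (EAdd (EVar 7) EOne)) (CAssign 11 ENil))))))).

(** In unary [k] could be exponentially long, so it is rebuilt as a real number from doubled powers
    of two, ready for comparison with the real counter in register 7. *)
Definition read_binary : cmd :=
  CSeq (CSeq (CAssign 8 (EVar 3)) (CSeq (CAssign 9 EOne) (CAssign 14 (ESub EOne EOne))))
    (CWhile (EVar 8)
      (CSeq (CIf (EHd (EVar 8)) (CAssign 14 (EAdd (EVar 14) (EVar 9))) (CAssign 12 ENil))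
      (CSeq (CAssign 9 (EAdd (EVar 9) (EVar 9))) (CAssign 8 (ETl (EVar 8)))))).

Definition answer_empty : cmd :=
  CSeq (CSeq (CAssign 8 (EVar 2)) (CAssign 9 ENil))
  (CSeq (CWhile (EVar 8) (CSeq (CAssign 9 (ECons ENil (EVar 9))) (CAssign 8 (ETl (EVar
      8)))))
    (CAssign 0 (ECons ENil (EVar 9)))).

(** [ETl (EVar 1)] is empty exactly for one-node digraphs, where [ENil] encodes the answer
    [None]. *)
Definition extension_program : cmd :=
  CSeq (CSeq (CAssign 1 (EHd (EVar 0)))
       (CSeq (CAssign 2 (EHd (ETl (EVar 0)))) (CAssign 3 (EHd (ETl (ETl (EVar 0)))))))
  (CIf (ETl (EVar 1))
    (CSeq sum_costs
    (CSeq make_fresh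
    (CSeq (CSeq (CAssign 6 (EVar 2)) (CAssign 7 (ESub EOne EOne)))
    (CSeq ask
    (CSeq keep_candidate
    (CSeq greedy_loop
    (CSeq read_binary
    (CIf (ELe (EVar 7) (EVar 14)) (CAssign 0 (ECons ENil (EVar 10))) answer_empty))))))))
    (CAssign 0 ENil)).

Lemma dsize_map_behead (R : realType) (T : Type) (f : T -> data R) x s w :
  dsize (dlist (map f (x :: s))) <= w -> dsize (dlist (map f s)) <= w.
Proof. by rewrite dsize_dlist_cons; apply/leq_trans/leqW/leq_addl. Qed.

Section ExtensionProgram.
Variables (R : realType) (O : data R -> data R) (N : network R).
Local Notation n1 := (last_node N).+1.
Local Notation m := (arcs N).
Let M : R := (1 + \sum_(a : 'I_m) cost a)%R.
Let M_ge0 : (0 <= M)%R.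
Proof. by apply: addr_ge0 => //; apply: sumr_ge0 => a _; apply: cost_ge0. Qed.
Let old (a : 'I_m) : data R := enc_arc (arc_tail a) (arc_head a) (cost a).
Let olds : seq (data R) := map old (enum 'I_m).
Let fresh (v : 'I_n1) : data R := enc_arc n1 v M.
Let kb : data R := dbinary R (nb_trees N).
(** A common bound for the encodings that the program handles; costs are stated in [W], which is
    made polynomial in the input size only at the end. *)
Variable W : nat.
Hypotheses (n1W : dsize (dunary R n1.+1) <= W) (oldsW : dsize (dlist olds) <= W).
Hypotheses (kbW : dsize kb <= W) (mW : m <= W).

Let W_gt0 : 0 < W.
Proof. by apply: leq_trans n1W; apply: dsize_gt0. Qed.

Lemma exec_sum_costs d0 d1 d3 :
  exec_le O sum_costs
    [:: d0; d1; dlist olds; d3; DNil; DNil; DNil; DNil; DNil; DNil; DNil; DNil; DNil;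
        DNil; DNil]
    (40 * (W * W))
    [:: d0; d1; dlist olds; d3; DReal M; DNil; DNil; DNil; DNil; DNil; DNil; DNil; DNil;
        DNil; DNil].
Proof.
pose S x as_ := [:: d0; d1; dlist olds; d3; DReal (x : R); DNil; DNil; DNil;
  dlist (map old as_); DNil; DNil; DNil; DNil; DNil; DNil].
apply: (exec_seq (l1 := S 1%R (enum 'I_m)) (B1 := W + 10)).
- by apply: exec_run => //=; move: oldsW; rewrite -/olds; move: (dsize (dlist _)) => q;
    clear; lia.
- have -> : M = foldl (fun x a => x + cost a)%R 1%R (enum 'I_m).
    have h : forall s x, foldl (fun x (a : 'I_m) => x + cost a)%R x s = (x + \sum_(a <-
        s) cost a)%R.
      elim=> [|a s IH] x; first by rewrite big_nil addr0.
      by rewrite big_cons /= IH addrA.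
    by rewrite h big_enum.
  apply: (exec_for (S := S) (c := W + 10) (Inv := fun _ as_ => dsize (dlist (map old
      as_)) <= W)) => //.
  move=> x a as_ inv; have inv' : dsize (dlist (map old as_)) <= W.
    exact: dsize_map_behead inv.
  split=> //; apply: exec_run => //=.
  by move: inv'; move: (dsize _) => q; clear; lia.
rewrite size_enum_ord; have : m * (W + 10).+1 <= W * (W + 10).+1 by rewrite leq_mul2r mW
    orbT.
have : W <= W * W by rewrite leq_pmulr.
by move: W_gt0; move: (m * _) => q; clear; lia.
Qed.

Definition fresh_copies (v : 'I_n1) (T : seq 'I_n1) : seq 'I_n1 :=
  foldl (fun T (_ : 'I_m) => v :: v :: T) T (enum 'I_m).

Definition all_fresh : seq 'I_n1 :=
  foldl (fun T v => fresh_copies v T) [::] (rev (enum 'I_n1)).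

Lemma fresh_copiesE v T : fresh_copies v T = nseq (m.*2) v ++ T.
Proof.
rewrite /fresh_copies -[m in RHS]size_enum_ord; elim: (enum _) T => //= a s IH T.
rewrite IH; elim: (size s) => //= k IHk; by rewrite -IHk.
Qed.

Lemma size_all_fresh : size all_fresh = n1 * m.*2.
Proof.
have h s T : size (foldl (fun T v => fresh_copies v T) T s) = size s * m.*2 + size T.
  elim: s T => //= v s IH T; rewrite IH fresh_copiesE size_cat size_nseq; lia.
by rewrite /all_fresh h size_rev size_enum_ord addn0.
Qed.

Lemma count_all_fresh v : m.*2 <= count_mem v all_fresh.
Proof.
have h s T : (v \in s) * m.*2 + count_mem v T <=
    count_mem v (foldl (fun T v => fresh_copies v T) T s).
  elim: s T => [|u s IH] T; first by rewrite mul0n.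
  apply: leq_trans (IH _); rewrite fresh_copiesE count_cat count_nseq inE /= eq_sym.
  case: (u == v); case: (v \in s); rewrite /= ?mul1n ?mul0n; move: (count_mem v T); lia.
by have := h (rev (enum 'I_n1)) [::]; rewrite mem_rev mem_enum mul1n addn0.
Qed.

Hypothesis listW : forall T K : seq 'I_n1, size T + size K <= n1 * m.*2 ->
  dsize (dlist (map fresh T ++ map fresh K ++ olds)) <= W.

Lemma freshW T : size T <= n1 * m.*2 -> dsize (dlist (map fresh T)) <= W.
Proof.
move=> le; have := @listW T [::]; rewrite addn0 => /(_ le).
have := dsize_dlist_cat (map fresh T) (map fresh [::] ++ olds).
have := dsize_gt0 (dlist (map fresh [::] ++ olds)).
by move: (dsize _) (dsize _) (dsize _) => a b c; clear; lia.
Qed.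

Lemma freshW1 v : 0 < m -> dsize (fresh v) <= W.
Proof.
move=> m0; have := @freshW [:: v]; rewrite [map _ _]/= dsize_dlist_cons => h.
apply: leq_trans (h _); last by rewrite muln_gt0 double_gt0 m0.
by move: (dsize _) (dsize _) => a b; clear; lia.
Qed.

Lemma exec_make_fresh d0 d3 :
  exec_le O make_fresh
    [:: d0; dunary R n1; dlist olds; d3; DReal M; DNil; DNil; DNil; DNil; DNil; DNil;
        DNil; DNil; DNil; DNil]
    (80 * (W * W * W))
    [:: d0; dunary R n1; dlist olds; d3; DReal M; dlist (map fresh all_fresh); DNil;
        DNil; DNil; DNil; DNil; DNil; DNil; DNil; DNil].
Proof.
pose S T (xs : seq 'I_n1) := [:: d0; dunary R n1; dlist olds; d3; DReal M;
    dlist (map fresh T);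
  DNil; DNil; dunary R (size xs); DNil; DNil; DNil; DNil; DNil; DNil].
have uW : forall u, u <= n1 -> dsize (dunary R u) <= W.
  by move=> u le; apply: leq_trans n1W; rewrite !dsize_dunary; lia.
apply: (exec_seq (l1 := S [::] (rev (enum 'I_n1))) (B1 := W + 10)).
- apply: exec_run => //=; first by rewrite /S size_rev size_enum_ord.
  by rewrite -[(1 + _).+1]/(dsize (dunary R n1)); have := uW n1 (leqnn _); lia.
(* The second part of the invariant says that the nodes to come count down to 0, so that register 8,
   once shortened, is the code of the node being treated. *)
- apply: (exec_for (S := S) (c := 60 * (W * W)) (Inv := fun T xs => size T + size xs *
    m.*2 <= n1 * m.*2 /\
     map val xs = rev (iota 0 (size xs)))) => //.
    move=> T v xs [inv1 inv2].
    have [vE inv2'] : val v = size xs /\ map val xs = rev (iota 0 (size xs)).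
      have e k : rev (iota 0 k.+1) = k :: rev (iota 0 k) by rewrite -[in LHS]addn1 iotaD
          rev_cat.
      by move: inv2; rewrite [size _]/= e => -[].
    have szT : size (fresh_copies v T) + size xs * m.*2 <= n1 * m.*2.
      rewrite fresh_copiesE size_cat size_nseq; move: inv1; rewrite /= mulSn; lia.
    split=> //.
    pose S' T (as_ : seq 'I_m) := [:: d0; dunary R n1; dlist olds; d3; DReal M;
        dlist (map fresh T);
       DNil; DNil; dunary R (size xs); dlist (map old as_); DNil; DNil; DNil; DNil; DNil].
    have xsn : size xs <= n1 by rewrite -vE ltnW // ltn_ord.
    apply: (exec_seq (l1 := S' T (enum 'I_m)) (B1 := W + W + 10)).
    + apply: exec_run => //=; have := uW _ xsn; move: oldsW; rewrite -/olds.
      by move: (dsize _) (dsize _) => a b; clear; lia.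
    + apply: (exec_for (S := S') (c := 10 * W + 30) (Inv := fun T as_ => size T + size
        as_ * 2 <= n1 * m.*2
         /\ dsize (dlist (map old as_)) <= W)) => //.
        move=> T' a as_ [i1 i2].
        have i2' : dsize (dlist (map old as_)) <= W.
          exact: dsize_map_behead i2.
        have m0 : 0 < m by apply: leq_ltn_trans (ltn_ord a).
        have fT : dsize (dlist (map fresh (v :: v :: T'))) <= W.
          by apply: freshW; move: i1; rewrite /=; lia.
        have fv := freshW1 v m0.
        split; first by split=> //; move: i1; rewrite /=; lia.
        apply: exec_run; first by [].
          by rewrite /S' /= /fresh vE.
        rewrite /= -vE -[((1 + dsize _).+1 + _).+1]/(dsize (fresh v)).
        move: fT fv i2'; rewrite [map _ (_ :: _)]/= !dsize_dlist_cons.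
        by move: (dsize _) (dsize _) (dsize _) => q1 q2 q3; clear; lia.
      split; last exact: oldsW.
      apply: leq_trans szT; rewrite fresh_copiesE size_cat size_nseq size_enum_ord.
      by move: (size xs * _) => q; clear; lia.
    rewrite size_enum_ord; have : m * (10 * W + 30).+1 <= W * (10 * W + 30).+1 by rewrite
        leq_mul2r mW orbT.
    have : W <= W * W by rewrite leq_pmulr.
    by move: W_gt0; move: (m * _) => q; clear; lia.
  split; first by rewrite size_rev size_enum_ord.
  by rewrite map_rev val_enum_ord size_rev size_enum_ord.
rewrite size_rev size_enum_ord.
have : n1 * (60 * (W * W)).+1 <= W * (60 * (W * W)).+1.
  by rewrite leq_mul2r; apply/orP; right; apply: leq_trans n1W; rewrite dsize_dunary; lia.
have : W <= W * W by rewrite leq_pmulr.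
have : W * W <= W * W * W by rewrite leq_pmulr.
by move: W_gt0; move: (n1 * _) => q; clear; lia.
Qed.

Lemma enc_ext_rooted (L : seq 'I_n1) : enc_rooted_network (ext_rooted M_ge0 L) =
  DCons (dunary R n1) (DCons (dunary R n1.+1)
    (DCons (dlist (map fresh L ++ olds)) (DCons kb DNil))).
Proof.
rewrite /enc_rooted_network enc_networkE /=; congr (DCons _ (DCons _ (DCons (dlist _) _))).
pose encT (t : 'I_n1.+1 * 'I_n1.+1 * R) : data R := enc_arc t.1.1 t.1.2 t.2.
transitivity (map encT (@ext_arcs R N M L)).
  by rewrite -[@ext_arcs R N M L in RHS]/(tval (in_tuple (@ext_arcs R N M L))) -[in
      RHS]map_tnth_enum -map_comp.
by rewrite map_cat /fresh_arcs /old_arcs -2!(map_comp encT).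
Qed.

Lemma listW_rev (T K : seq 'I_n1) : size T + size K <= n1 * m.*2 ->
  dsize (dlist (map fresh (rev T ++ K) ++ olds)) <= W.
Proof. by move=> le; rewrite map_cat -catA; apply: listW; rewrite size_rev. Qed.

Lemma answer_size (T K : seq 'I_n1) (H : {set 'I_(size (@ext_arcs R N M (rev T ++ K)))}) :
  size T + size K <= n1 * m.*2 -> dsize (enc_arc_set R (Some H)) <= 4 * W + 3.
Proof.
move=> le; apply: leq_trans (dsize_enc_arc_set _ _) _; rewrite leq_add2r leq_mul2l /=.
apply: leq_trans (listW_rev le); apply: leq_trans (size_dlist _).
by rewrite size_ext_arcs [size (_ ++ olds)]size_cat 2!size_map size_enum_ord.
Qed.

Lemma exec_ask (T K : seq 'I_n1) H d0 d2 d4 d7 d10 d11 d12 d13 d14 :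
  size T + size K <= n1 * m.*2 ->
  O (enc_rooted_network (ext_rooted M_ge0 (rev T ++ K)))
    = enc_arc_set R (Some (H : {set 'I_(size (@ext_arcs R N M (rev T ++ K)))})) ->
  exec_le O ask
    [:: d0; dunary R n1; d2; kb; d4; dlist (map fresh T); dlist (map fresh K ++ olds); d7;
       DNil; DNil; d10; d11; d12; d13; d14]
    (100 * (W * W))
    [:: d0; dunary R n1; d2; kb; d4; dlist (map fresh T); dlist (map fresh K ++ olds); d7;
       DNil; DNil; d10; d11; enc_arc_set R (Some H); d13; d14].
Proof.
move=> le OH; have lW := listW_rev le.
have eL : catrev (map fresh T) (map fresh K ++ olds) = map fresh (rev T ++ K) ++ olds.
  by rewrite map_cat map_rev catrevE catA.
have szL := dsize_dlist_catrev (map fresh T) (map fresh K ++ olds); rewrite eL in szL.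
have szT : size (map fresh T) <= W.
  apply: leq_trans lW; apply: leq_trans (size_dlist _).
  by rewrite map_cat !size_cat !size_map size_rev -addnA leq_addr.
apply: (exec_seq (B1 := 2 * W + 10) (l1 := [:: d0; dunary R n1; d2; kb; d4;
    dlist (map fresh T);
   dlist (map fresh K ++ olds); d7; dlist (map fresh T); dlist (map fresh K ++ olds);
       d10; d11; d12; d13; d14])).
- apply: exec_run => //=.
  by move: szL lW; move: (dsize _) (dsize _) (dsize _) => a b c; clear; lia.
- apply: (exec_seq (B1 := (W * (W.+1.*2 + 6)).+1) (l1 := [:: d0; dunary R n1; d2; kb; d4;
    dlist (map fresh T);
   dlist (map fresh K ++ olds); d7; DNil; dlist (map fresh (rev T ++ K) ++ olds); d10;
       d11; d12; d13; d14])).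
  + apply: (exec_le_eq _ _ _ (@exec_copy_rev _ _ 8 9 _ (map fresh T) (map fresh K ++
      olds) W.+1 _ _ _ _)) => //.
      by rewrite eL.
      by rewrite ltnS leq_mul2r szT orbT.
    by rewrite -szL addn1.
  + apply: (exec_seq (B2 := 2) (l1 := [:: d0; dunary R n1; d2; kb; d4; dlist (map fresh T);
   dlist (map fresh K ++ olds); d7; DNil; dlist (map fresh (rev T ++ K) ++ olds); d10;
       d11; enc_arc_set R (Some H); d13; d14])).
    * apply: (exec_le_eq _ _ (leqnn _) (exec_query _ _ _ _)) => //.
      rewrite -[eval _ _]/(DCons (dunary R n1) (DCons (dunary R n1.+1)
         (DCons (dlist (map fresh (rev T ++ K) ++ olds)) (DCons kb DNil))))
             -enc_ext_rooted OH.
      reflexivity.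
    * exact: exec_run.
    * exact: leqnn.
  exact: leqnn.
rewrite -[eval _ _]/(DCons (dunary R n1) (DCons (dunary R n1.+1)
   (DCons (dlist (map fresh (rev T ++ K) ++ olds)) (DCons kb DNil)))) -enc_ext_rooted OH.
have := answer_size H le; rewrite enc_ext_rooted; move: (dsize (enc_arc_set _ _)) => q.
have : dsize (dunary R n1) <= W by apply: leq_trans n1W; rewrite !dsize_dunary; lia.
rewrite -[dsize (DCons _ _)]/((dsize (dunary R n1) + (dsize (dunary R n1.+1)
   + (dsize (dlist (map fresh (rev T ++ K) ++ olds)) + (dsize kb + 1).+1).+1).+1).+1).
have : W <= W * W by rewrite leq_pmulr.
move: n1W lW kbW W_gt0; move: (dsize (dunary R n1.+1)) (dsize (dunary R n1)) (dsize
    (dlist _)) (dsize kb) => a b c d.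
by clear; lia.
Qed.

Lemma exec_scan_answer mm (H : {set 'I_mm}) w d0 d1 d2 d3 d4 d5 d6 d7 d9 d10 d11 d14 :
  dsize (enc_arc_set R (Some H)) <= w ->
  exec_le O scan_answer
    [:: d0; d1; d2; d3; d4; d5; d6; d7; DNil; d9; d10; d11; enc_arc_set R (Some H); DNil;
        d14]
    (w * (w + 20) + w + 20)
    [:: d0; d1; d2; d3; d4; d5; d6; d7; DNil; d9; d10; d11; DNil; dbool R (H != set0); d14].
Proof.
move=> le.
pose S (f : bool) as_ := [:: d0; d1; d2; d3; d4; d5; d6; d7; DNil; d9; d10; d11;
   dlist [seq dbool R (a \in H) | a <- as_]; dbool R f; d14].
have le' : dsize (dlist [seq dbool R (a \in H) | a <- enum 'I_mm]) <= w.
  by apply: leq_trans le; rewrite /= ltnW.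
apply: (exec_seq (B1 := w + 2) (l1 := S false (enum 'I_mm))).
- by apply: exec_run => //=; move: le'; move: (dsize _) => q; clear; lia.
- have -> : (H != set0) = foldl (fun f a => f || (a \in H)) false (enum 'I_mm).
    have h s f : foldl (fun f (a : 'I_mm) => f || (a \in H)) f s = f || has (mem H) s.
      by elim: s f => [|a s IH] f /=; rewrite ?orbF // IH orbA.
    rewrite h /=; apply/set0Pn/hasP => [[a aH]|[a _ aH]]; exists a => //.
    by rewrite mem_enum.
  apply: (exec_for (S := S) (c := w + 15) (Inv := fun _ as_ =>
     dsize (dlist [seq dbool R (a \in H) | a <- as_]) <= w)) => //.
  move=> f a as_ inv; have inv' := dsize_map_behead inv; split=> //.
  apply: exec_run => //=.
    by case: (a \in H); rewrite /= ?orbT ?orbF.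
  case: (a \in H) => /=; move: inv'; move: (dsize _) => q; clear; lia.
rewrite size_enum_ord; have : mm * (w + 15).+1 <= w * (w + 15).+1.
  rewrite leq_mul2r; apply/orP; right; apply: leq_trans le'.
  by apply: leq_trans (size_dlist _); rewrite size_map size_enum_ord.
by move: (mm * _) => q; clear; lia.
Qed.

Lemma exec_keep_candidate (T : seq 'I_n1) (H : {set 'I_(size (@ext_arcs R N M T))}) w d0
    d1 d2 d3 d4 d6 d7 d9 d11 d13 d14 :
  dsize (enc_arc_set R (Some H)) <= w -> dsize (dlist (map fresh (rev T))) <= w ->
  exec_le O keep_candidate
    [:: d0; d1; d2; d3; d4; dlist (map fresh (rev T)); d6; d7; DNil; d9; DNil; d11;
        enc_arc_set R (Some H); d13; d14]
    (w * (2 * w + 10) + 2 * w + 20)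
    [:: d0; d1; d2; d3; d4; dlist (map fresh (rev T)); d6; d7; DNil; d9;
       dlist [seq dbool R (a \in @ext_arc R N M T @^-1: H) | a <- enum 'I_m]; d11; DNil;
           d13; d14].
Proof.
move=> leH leT.
pose bs0 := [seq dbool R (a \in H) | a <- enum 'I_(size (@ext_arcs R N M T))].
have lebs : dsize (dlist bs0) <= w by apply: leq_trans leH; rewrite /= ltnW.
pose S bs us := [:: d0; d1; d2; d3; d4; dlist (map fresh (rev T)); d6; d7;
    dlist (map fresh us); d9;
       dlist (bs : seq (data R)); d11; DNil; d13; d14].
apply: (exec_seq (B1 := 2 * w + 10) (l1 := S bs0 (rev T))).
- by apply: exec_run => //=; move: lebs leT; rewrite -/bs0;
    move: (dsize _) (dsize _) => q q'; clear; lia.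
- have -> : [seq dbool R (a \in @ext_arc R N M T @^-1: H) | a <- enum 'I_m]
      = foldl (fun bs _ => behead bs) bs0 (rev T).
    have h (s : seq 'I_n1) (bs : seq (data R)) : foldl (fun bs _ => behead bs) bs s =
        drop (size s) bs.
      elim: s bs => [|u s IH] [|b bs] //=; rewrite ?drop0 // IH //.
    have sz0 : size (@ext_arcs R N M T) = size T + m by rewrite size_ext_arcs.
    rewrite h size_rev; apply: (@eq_from_nth _ DNil).
      by rewrite size_drop /bs0 2!size_map !size_enum_ord sz0 addKn.
    move=> i; rewrite size_map size_enum_ord => im.
    rewrite nth_drop (nth_map (Ordinal im)) ?size_enum_ord //.
    have lt : size T + i < size (@ext_arcs R N M T) by rewrite sz0 ltn_add2l.
    rewrite (nth_map (Ordinal lt)) ?size_enum_ord // inE; congr (dbool R (_ \in H)).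
    by apply: val_inj; rewrite /= nth_enum_ord // nth_enum_ord.
  apply: (exec_for (S := S) (c := 2 * w + 5) (Inv := fun bs us =>
     dsize (dlist bs) <= w /\ dsize (dlist (map fresh us)) <= w)) => //.
  move=> bs u us [i1 i2]; have i2' := dsize_map_behead i2.
  have i1' : dsize (dlist (behead bs)) <= w.
    by apply: leq_trans i1; case: (bs) => // b bs'; rewrite dsize_dlist_cons;
        apply/leqW/leq_addl.
  split=> //; apply: exec_run => //; first by rewrite /S; case: (bs).
  have -> : (run (CSeq (CAssign 10 (ETl (EVar 10))) (CAssign 8 (ETl (EVar 8)))) (S bs (u
      :: us))).2
     = ((dsize (dlist (behead bs))).+1 + (dsize (dlist (map fresh us))).+1).+1 by case:
         (bs).
  by move: i1' i2'; move: (dsize _) (dsize _) => q q'; clear; lia.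
have : size (rev T) * (2 * w + 5).+1 <= w * (2 * w + 5).+1.
  rewrite leq_mul2r; apply/orP; right; apply: leq_trans leT.
  by apply: leq_trans (size_dlist _); rewrite size_map.
by move: (size _ * _) => q; clear; lia.
Qed.


Lemma exec_read_binary d0 d1 d2 d4 d5 d6 d7 d10 d11 d13 :
  exists d9, exec_le O read_binary
    [:: d0; d1; d2; kb; d4; d5; d6; d7; DNil; DNil; d10; d11; DNil; d13; DNil]
    (60 * (W * W))
    [:: d0; d1; d2; kb; d4; d5; d6; d7; DNil; d9; d10; d11; DNil; d13;
        DReal (nb_trees N)%:R%R].
Proof.
pose kk := nb_trees N; pose bit i := odd (kk %/ 2 ^ i).
pose g (xp : R * R) i : R * R := ((if bit i then xp.1 + xp.2 else xp.1)%R, (xp.2 + xp.2)%R).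
have gE L : foldl g (0, 1)%R (iota 0 L) = ((kk %% 2 ^ L)%:R, (2 ^ L)%:R)%R.
  elim: L => [|L IH]; first by rewrite modn1.
  rewrite -addn1 iotaD foldl_cat IH add0n /= /g /= addn1 expnS mul2n -addnn natrD.
  congr (_, _)%R.
  have -> : kk %% (2 ^ L + 2 ^ L) = bit L * 2 ^ L + kk %% 2 ^ L.
    have e : kk = (kk %/ 2 ^ L)./2 * (2 ^ L + 2 ^ L) + (bit L * 2 ^ L + kk %% 2 ^ L).
      rewrite {1}(divn_eq kk (2 ^ L)) -{1}(odd_double_half (kk %/ 2 ^ L)) -/(bit L).
      by rewrite -muln2 mulnDl -mulnA mul2n addnn; lia.
    rewrite [X in X %% (_ + _)]e modnMDl modn_small //; have := ltn_pmod kk (expn_gt0 2 L).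
    by move: (kk %% 2 ^ L) => r; move: (2 ^ L) => y; case: (bit L);
        rewrite ?mul1n ?mul0n; clear; lia.
  by case: (bit L); rewrite ?mul1n ?mul0n ?add0n // natrD addrC.
pose L := (trunc_log 2 kk).+1.
have kbE : kb = dlist [seq dbool R (bit i) | i <- iota 0 L] by [].
pose S (xp : R * R) is_ := [:: d0; d1; d2; kb; d4; d5; d6; d7;
    dlist [seq dbool R (bit i) | i <- is_];
  DReal xp.2; d10; d11; DNil; d13; DReal xp.1].
exists (DReal (2 ^ L)%:R%R).
apply: (exec_seq (B1 := W + 15) (l1 := S (0, 1)%R (iota 0 L))).
- apply: exec_run => //; first by rewrite /S /= subrr.
  rewrite -[(run _ _).2]/((dsize kb).+1 + (2 + 2).+1).+1.
  by move: kbW; move: (dsize _) => q; clear; lia.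
(* [kk < 2 ^ L], so the remainder reached after the last digit is [kk] itself. *)
- have -> : kk%:R%R = (foldl g (0, 1)%R (iota 0 L)).1.
    by rewrite gE /= modn_small // trunc_log_ltn.
  have -> : (2 ^ L)%:R%R = (foldl g (0, 1)%R (iota 0 L)).2 by rewrite gE.
  apply: (exec_for (S := S) (c := W + 25) (Inv := fun _ is_ =>
    dsize (dlist [seq dbool R (bit i) | i <- is_]) <= W)); last by rewrite -kbE.
  + by [].
  + by [].
  move=> xp i is_ inv; have inv' := dsize_map_behead inv; split=> //.
  apply: exec_run => //=; first by rewrite /g; case: (bit i).
  by case: (bit i) => /=; move: inv'; move: (dsize _) => q; clear; lia.
rewrite size_iota; have LW : L <= W.
  by apply: leq_trans kbW; apply: leq_trans (size_dlist _); rewrite size_map size_iota.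
have : L * (W + 25).+1 <= W * (W + 25).+1 by rewrite leq_mul2r LW orbT.
have : W <= W * W by rewrite leq_pmulr.
by move: W_gt0; move: (L * _) => q; clear; lia.
Qed.

Lemma exec_answer_empty d0 d1 d3 d4 d5 d6 d7 d8 d9 d10 d11 d12 d13 d14 :
  exec_le O answer_empty
    [:: d0; d1; dlist olds; d3; d4; d5; d6; d7; d8; d9; d10; d11; d12; d13; d14]
    (60 * (W * W))
    [:: enc_arc_set R (Some (set0 : {set 'I_m})); d1; dlist olds; d3; d4; d5; d6; d7;
       DNil; dlist (nseq m DNil); d10; d11; d12; d13; d14].
Proof.
pose S j as_ := [:: d0; d1; dlist olds; d3; d4; d5; d6; d7; dlist (map old as_);
    dlist (nseq j DNil);
   d10; d11; d12; d13; d14].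
have enc0 : enc_arc_set R (Some (set0 : {set 'I_m})) = DCons DNil (dlist (nseq m DNil)).
  rewrite /enc_arc_set; congr (DCons _ (dlist _)); rewrite -[m in RHS]size_enum_ord.
  by elim: (enum _) => //= a s ->; rewrite inE.
have sz j : dsize (dlist (nseq j (DNil : data R))) = j.*2.+1 by exact: dsize_dunary.
apply: (exec_seq (B1 := W + 5) (l1 := S 0 (enum 'I_m))).
- by apply: exec_run => //=; move: oldsW; rewrite -/olds; move: (dsize _) => q; clear; lia.
- apply: (exec_seq (B2 := 2 * W + 10) (l1 := S m [::])).
  + have fm : foldl (fun j (_ : 'I_m) => j.+1) 0 (enum 'I_m) = m.
      have h (s : seq 'I_m) j : foldl (fun j _ => j.+1) j s = size s + j.
        by elim: s j => //= a s IH j; rewrite IH addnS.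
      by rewrite h addn0 size_enum_ord.
    apply: (exec_le_eq (l2 := S (foldl (fun j (_ : 'I_m) => j.+1) 0 (enum 'I_m)) [::])
      (erefl _) _ (leqnn _)); first by rewrite fm.
    apply: (exec_for (S := S) (c := 3 * W + 15) (Inv := fun j as_ => j + size as_ <= m /\
      dsize (dlist (map old as_)) <= W)).
    * by [].
    * by [].
    * move=> j a as_ [i1 i2]; have i2' := dsize_map_behead i2.
      split; first by split=> //; move: i1; rewrite /= addnS.
      apply: exec_run => //.
      rewrite -[(run _ _).2]/((1 + dsize (dlist (nseq j (DNil : data R)))).+2 +
         (dsize (dlist (map old as_))).+1).+1 sz.
      move: i1 i2' mW; rewrite /=; move: (dsize _) => q; clear; lia.
    split; first by rewrite size_enum_ord.
    exact: oldsW.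
  + apply: exec_run => //; first by rewrite enc0.
    rewrite -[(run _ _).2]/(1 + dsize (dlist (nseq m (DNil : data R)))).+2 sz.
    by move: mW; clear; lia.
  exact: leqnn.
rewrite size_enum_ord; have : m * (3 * W + 15).+1 <= W * (3 * W + 15).+1 by rewrite
    leq_mul2r mW orbT.
have : W <= W * W by rewrite leq_pmulr.
by move: W_gt0; move: (m * _) => q; clear; lia.
Qed.

Hypothesis solO : solves (blocking_rooted_k_arborescences R) O.

Lemma oracle_answer (L : seq 'I_n1) : exists H : {set 'I_(size (@ext_arcs R N M L))},
  [/\ O (enc_rooted_network (ext_rooted M_ge0 L)) = enc_arc_set R (Some H),
    correct (blocking_rooted_k_arborescences R) (ext_rooted M_ge0 L) (Some H)
    & (H != set0) = feasible L].
Proof.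
have [ans cor eO] := solO (ext_rooted M_ge0 L).
by have [H eH fe] := ext_answer cor; exists H; rewrite -eH.
Qed.

(** A round moves one arc from [T] to [K] or drops it, so the joint length never grows and every
    query stays within [W]. It costs order [W * W] because the query list is copied cell by cell and
    each step is charged for whole lists. *)
Lemma exec_greedy_loop T K d0 d2 d4 d10 :
  size T + size K <= n1 * m.*2 ->
  let S T (K : seq 'I_n1) := [:: d0; dunary R n1; d2; kb; d4; dlist (map fresh T);
    dlist (map fresh K ++ olds); DReal (size K)%:R%R; DNil; DNil; d10; DNil; DNil; DNil;
        DNil] in
  exec_le O greedy_loop (S T K) (size T * (400 * (W * W)).+1).+1 (S [::] (greedy T K)).
Proof.
move=> + S; elim: T K => [|v T IH] K le.
  by exists 1 => //; apply: ExecWhileFalse.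
have le0 : size T + size K <= n1 * m.*2 by apply: leq_trans le; rewrite /= addSn.
have le1 : size T + size (if feasible (rev T ++ K) then K else v :: K) <= n1 * m.*2.
  by case: ifP => _ //; move: le; rewrite /= addnS.
have [t2 ex2 b2] := IH _ le1; rewrite [greedy _ _]/=.
suff [t1 ex1 b1] : exec_le O (CSeq (CSeq (CAssign 11 (EHd (EVar 5))) (CAssign 5 (ETl
    (EVar 5))))
    (CSeq ask (CSeq scan_answer (CIf (EVar 13) (CSeq (CAssign 11 ENil) (CAssign 13 ENil))
      (CSeq (CAssign 6 (ECons (EVar 11) (EVar 6)))
        (CSeq (CAssign 7 (EAdd (EVar 7) EOne)) (CAssign 11 ENil)))))))
    (S (v :: T) K) (400 * (W * W)) (S T (if feasible (rev T ++ K) then K else v :: K)).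
  exists (t1 + t2).+1; first exact: ExecWhileTrue ex1 ex2.
  by rewrite [size _]/= mulSn ltnS addSn -addnS leq_add.
have m0 : 0 < m by move: le; rewrite /=; case: (m) => //; rewrite muln0.
have [H [OH _ feH]] := oracle_answer (rev T ++ K).
have fv := freshW1 v m0.
have fT : dsize (dlist (map fresh T)) <= W by apply: freshW; apply: leq_trans le0;
    apply: leq_addr.
have fK : dsize (dlist (map fresh K ++ olds)) <= W.
  by apply: (@listW [::] K); apply: leq_trans le0; rewrite leq_addl.
pose L a11 d12 d13 := [:: d0; dunary R n1; d2; kb; d4; dlist (map fresh T);
    dlist (map fresh K ++ olds); DReal (size K)%:R%R; DNil; DNil; d10; a11; d12; d13; DNil].
apply: (exec_seq (B1 := 2 * W + 10) (l1 := L (fresh v) DNil DNil)).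
- apply: exec_run => //.
  rewrite -[(run _ _).2]/((dsize (fresh v)).+1 + (dsize (dlist (map fresh T))).+1).+1.
  by move: fv fT; move: (dsize _) (dsize _) => a b; clear; lia.
- apply: (exec_seq (l1 := L (fresh v) (enc_arc_set R (Some H)) DNil)).
  + exact: exec_ask.
  + apply: (exec_seq (l1 := L (fresh v) DNil (dbool R (H != set0)))).
    * by apply: (exec_scan_answer (w := 4 * W + 3)); apply: answer_size.
    * apply: (exec_run (B := 2 * W + 30)) => //.
        rewrite feH; case: (feasible _) => //.
        by rewrite /S /L /= -natr1.
      rewrite feH; case: (feasible _); first by rewrite /=; clear; lia.
      rewrite -[(run _ _).2]/((dsize (fresh v) + dsize (dlist (map fresh K ++ olds))).+2
          + (2 + 2).+1).+2.
      by move: fv fK; move: (dsize _) (dsize _) => a b; clear; lia.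
    exact: leqnn.
  exact: leqnn.
have : W <= W * W by rewrite leq_pmulr.
by move: W_gt0; clear; lia.
Qed.


(** The type of [H] depends on the queried list, which is [rev all_fresh ++ [::]] and only
    propositionally equal to [rev all_fresh]; hence the free [L] with an equation. *)
Lemma reduction_correct (L : seq 'I_n1) (H : {set 'I_(size (@ext_arcs R N M L))}) :
  L = rev all_fresh -> 0 < last_node N ->
  correct (blocking_rooted_k_arborescences R) (ext_rooted M_ge0 L) (Some H) ->
  correct (blocking_k_arborescences R) N
    (Some (if size (greedy all_fresh [::]) <= nb_trees N then @ext_arc R N M L @^-1: H
        else set0)).
Proof.
move=> eL; case: _ / (esym eL) H => H n0 cor.
have bigM : (\sum_(a : 'I_m) cost a < M)%R by rewrite ltrDr.
by have [H' [<-]] := reduction_answer bigM n0 count_all_fresh cor.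
Qed.

Lemma exec_extension_program : 0 < last_node N ->
  exists (l : seq (data R)) (X : {set 'I_m}),
  [/\ sto l 0 = enc_arc_set R (Some X),
    correct (blocking_k_arborescences R) N (Some X) &
    exec_le O extension_program (enc_network N :: nseq 14 DNil) (1500 * (W * W * W)) l].
Proof.
move=> n0; pose T := all_fresh; pose d0 := enc_network N.
have [H [OH cor _]] := oracle_answer (rev T ++ [::]).
have szT : size T + size (Nil 'I_n1) <= n1 * m.*2 by rewrite addn0 size_all_fresh.
pose X := @ext_arc R N M (rev T ++ [::]) @^-1: H.
have corX := reduction_correct (cats0 _) n0 cor; rewrite -/X in corX.
pose bits := [seq dbool R (a \in X) | a <- enum 'I_m].
have eT : rev (rev T ++ [::]) = T by rewrite cats0 revK.
have fT : dsize (dlist (map fresh T)) <= W by apply: freshW; rewrite size_all_fresh.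
have [d9 rb] := exec_read_binary d0 (dunary R n1) (dlist olds) (DReal M) (dlist (map
    fresh [::]))
  (dlist (map fresh (greedy T [::]) ++ olds)) (DReal (size (greedy T [::]))%:R%R) (dlist
      bits) DNil DNil.
pose Y := if size (greedy T [::]) <= nb_trees N then X else set0.
pose tl := [:: dunary R n1; dlist olds; kb; DReal M; dlist (map fresh [::]);
   dlist (map fresh (greedy T [::]) ++ olds); DReal (size (greedy T [::]))%:R%R].
pose le := size (greedy T [::]) <= nb_trees N.
have ansW : dsize (enc_arc_set R (Some H)) <= 4 * W + 3 by apply: answer_size.
exists (enc_arc_set R (Some Y) :: tl ++ [:: DNil; if le then d9 else dlist (nseq m DNil);
  dlist bits; DNil; DNil; DNil; DReal (nb_trees N)%:R%R]), Y; split=> //.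
have nW : dsize (dunary R n1) <= W by apply: leq_trans n1W; rewrite !dsize_dunary; lia.
have WW : W <= W * W by rewrite leq_pmulr.
have WWW : W * W <= W * W * W by rewrite leq_pmulr.
apply: (exec_seq (B1 := 3 * W + 20) (l1 := [:: d0; dunary R n1; dlist olds;
    kb] ++ nseq 11 DNil)).
- apply: exec_run => //.
  rewrite -[(run _ _).2]/((dsize (dunary R n1)).+1 + ((dsize (dlist olds)).+1 + (dsize
      kb).+1).+1).+1.
  by move: nW oldsW kbW; move: (dsize _) (dsize _) (dsize _) => a b c; clear; lia.
- apply: (@exec_if _ _ _ _ _ _ _ (1450 * (W * W * W))).
  have -> : dtrue (eval (sto ([:: d0; dunary R n1; dlist olds;
      kb] ++ nseq 11 DNil)) (ETl (EVar 1))) = true.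
    by move: n0; case: (last_node N).
  apply: exec_seq (exec_sum_costs _ _ _) _ _.
    apply: exec_seq (exec_make_fresh _ _) _ _.
      apply: (exec_seq (B1 := W + 10) (l1 := [:: d0; dunary R n1; dlist olds; kb;
          DReal M; dlist (map fresh T);
        dlist (map fresh [::] ++ olds); DReal (size (Nil 'I_n1))%:R%R] ++ nseq 7 DNil)).
      - apply: exec_run => //; first by rewrite /= subrr.
        rewrite -[(run _ _).2]/((dsize (dlist olds)).+1 + 2).+1.
        by move: oldsW; move: (dsize _) => a; clear; lia.
      - apply: exec_seq (exec_ask _ _ _ _ _ _ _ _ _ szT OH) _ _.
          apply: (exec_seq (l1 := [:: d0; dunary R n1; dlist olds; kb; DReal M;
              dlist (map fresh T);
              dlist (map fresh [::] ++ olds); DReal (size (Nil 'I_n1))%:R%R; DNil; DNil;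
                  dlist bits; DNil; DNil; DNil; DNil])
              (B1 := (4 * W + 3) * (2 * (4 * W + 3) + 10) + 2 * (4 * W + 3) + 20)).
          - rewrite /bits -[in dlist (map fresh T)]eT; apply: exec_keep_candidate => //.
            by rewrite eT; apply: leq_trans fT _; clear; lia.
          - apply: exec_seq (exec_greedy_loop _ _ _ _ szT) _ _.
              apply: exec_seq rb _ _.
                apply: (@exec_if _ _ _ _ _ _ _ (61 * (W * W))).
                have -> : dtrue (eval (sto [:: d0; dunary R n1; dlist olds; kb; DReal M;
                    dlist (map fresh [::]);
                    dlist (map fresh (greedy T [::]) ++ olds);
                        DReal (size (greedy T [::]))%:R%R; DNil; d9;
                    dlist bits; DNil; DNil; DNil; DReal (nb_trees N)%:R%R]) (ELe (EVar 7)
                        (EVar 14))) = le.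
                  by rewrite /= ler_nat -/le; case: le.
                rewrite /Y -/le; case: le.
                  apply: exec_run => //.
                  have := dsize_enc_arc_set R (Some X).
                  rewrite -[(run _ _).2]/(dsize (enc_arc_set R (Some X))).+1.
                  by move: mW W_gt0 WW; move: (dsize _) => a; clear; lia.
                apply: (exec_le_eq (erefl _) (erefl _) _ (exec_answer_empty _ _ _ _ _ _ _
                    _ _ _ _ _ _ _)).
                by rewrite leq_mul2r leqnSn orbT.
              exact: leqnn.
            exact: leqnn.
          exact: leqnn.
        exact: leqnn.
      exact: leqnn.
    exact: leqnn.
  have : size T * (400 * (W * W)).+1 <= W * (400 * (W * W)).+1.
    rewrite leq_mul2r; apply/orP; right; apply: leq_trans fT.
    by apply: leq_trans (size_dlist _); rewrite size_map.
  by move: W_gt0 WW WWW; move: (size T * _) => q; clear; lia.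
by move: W_gt0 WW WWW; clear; lia.
Qed.

End ExtensionProgram.

Lemma single_node_answer (R : realType) (N : network R) : last_node N = 0 ->
  correct (blocking_k_arborescences R) N None.
Proof.
move=> n0 /= H tH.
have one (u v : 'I_(last_node N).+1) : u = v.
  by apply: val_inj; move: (ltn_ord u) (ltn_ord v) n0 => /=; clear; lia.
have arb : @k_arborescence (net_graph N) (nb_trees N) set0.
  apply/(packing_root_choice _ _ (ord0 : node (net_graph N))).
  exists (fun=> set0), (fun=> ord0); split=> [i|i j _|].
  - split=> [v|X rX /set0Pn[v vX]]; last by move: vX rX; rewrite (one v ord0) => ->.
    rewrite (one v ord0) eqxx; apply/eqP; rewrite cards_eq0.
    by apply/eqP/setP => a; rewrite !inE.
  - by rewrite -setI_eq0 setI0.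
  - by rewrite big1.
have /tH : min_cost (@cost R N) (@k_arborescence (net_graph N) (nb_trees N)) set0.
  split=> // F _; rewrite big_set0; apply: sumr_ge0 => a _; exact: cost_ge0.
by rewrite setI0 eqxx.
Qed.

Lemma unrooted_reducible (R : realType) :
  poly_time_reducible (blocking_k_arborescences R) (blocking_rooted_k_arborescences R).
Proof.
have [b hb] := monomial_bound (1500 * 30 ^ 3) 9.
exists extension_program, b => O sol N.
(* There are at most [z * z] new arcs, of size at most [4 * z] each, hence [W] of order [z ^ 3]; the
   program is cubic in [W], which gives degree 9. *)
pose z := dsize (enc_network N); pose W := 30 * z ^ 3.
have z0 : 0 < z by apply: dsize_gt0.
have hz1 : z <= z ^ 3 by rewrite -{1}[z]expn1 leq_pexp2l.
have hz0 : 0 < z ^ 3 by rewrite expn_gt0 z0.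
have boundE : (b.[dsize (enc_instance N)])%R = 1500 * (W * W * W).
  have <- : 30 ^ 3 * z ^ 9 = W * W * W by rewrite -[9]/(3 * 3) expnM -expnMn -/W -mulnA.
  by rewrite hb -/z mulnA.
have initE : init_store (enc_instance N) = sto (enc_network N :: nseq 14 DNil).
  by apply/funext; do 16 case=> //.
pose old (a : 'I_(arcs N)) : data R := enc_arc (arc_tail a) (arc_head a) (cost a).
have [nz oz kz] : [/\ (last_node N).+1.*2 < z, dsize (dlist (map old (enum 'I_(arcs N))))
    <= z
    & dsize (dbinary R (nb_trees N)) <= z].
  have : z = (dsize (dunary R (last_node N).+1) + (dsize (dlist (map old (enum 'I_(arcs
      N))))
     + (dsize (dbinary R (nb_trees N)) + 1).+1).+1).+1 by [].
  by rewrite dsize_dunary => ->; split; move: (dsize _) (dsize _) => p q; clear; lia.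
have mz : arcs N <= z.
  by apply: leq_trans oz; apply: leq_trans (size_dlist _); rewrite size_map size_enum_ord.
have [n0|n0] := posnP (last_node N).
  have [t ex le] : exec_le O extension_program (enc_network N :: nseq 14 DNil) (1500 * (W
      * W * W))
      ([:: DNil; dunary R (last_node N).+1; dlist (map old (enum 'I_(arcs N)));
        dbinary R (nb_trees N)] ++ nseq 11 DNil).
    apply: (exec_seq (B1 := 3 * z + 20) (B2 := 3) (l1 := [:: enc_network N;
        dunary R (last_node N).+1;
        dlist (map old (enum 'I_(arcs N))); dbinary R (nb_trees N)] ++ nseq 11 DNil)).
    - apply: exec_run => //.
      rewrite -[(run _ _).2]/((dsize (dunary R (last_node N).+1)).+1 +
        ((dsize (dlist (map old (enum 'I_(arcs N))))).+1 + (dsize (dbinary R (nb_trees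
            N))).+1).+1).+1.
      rewrite dsize_dunary; move: nz oz kz;
          move: (dsize (dlist _)) (dsize (dbinary _ _)) => p q.
      by clear; lia.
    - by apply: exec_if; rewrite /= n0; apply: exec_run.
    have : W <= W * W * W by rewrite -mulnA leq_pmulr // !muln_gt0 /= hz0.
    by rewrite {1}/W; move: (W * W * W) z0 hz1 => q; clear; lia.
  exists t, (sto ([:: DNil; dunary R (last_node N).+1; dlist (map old (enum 'I_(arcs N)));
        dbinary R (nb_trees N)] ++ nseq 11 DNil)), None.
  split=> //; [by rewrite initE|by rewrite boundE|exact: single_node_answer].
have nW : dsize (dunary R (last_node N).+2) <= W.
  by rewrite dsize_dunary /W; move: nz hz1; clear; lia.
have zW : z <= W by apply: leq_trans hz1 _; rewrite leq_pmull.
pose fresh (v : 'I_(last_node N).+1) : data R :=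
  enc_arc (last_node N).+1 v (1 + \sum_(a : 'I_(arcs N)) cost a)%R.
have listW (T K : seq 'I_(last_node N).+1) :
    size T + size K <= (last_node N).+1 * (arcs N).*2 ->
    dsize (dlist (map fresh T ++ map fresh K ++ map old (enum 'I_(arcs N)))) <= W.
  move=> le; rewrite catA -map_cat.
  have fz v : dsize (fresh v) <= 4 * z.
    by rewrite dsize_enc_arc; move: (ltn_ord v) nz; clear; lia.
  have := dsize_dlist_cat (map fresh (T ++ K)) (map old (enum 'I_(arcs N))).
  have := dsize_dlist_map_le (T ++ K) fz; rewrite size_cat.
  have le2 : size T + size K <= z * z.
    apply: leq_trans le _; rewrite -doubleMr doubleMl leq_mul //.
    by apply: ltnW.
  have : (size T + size K) * (4 * z).+1 <= z * z * (4 * z).+1 by rewrite leq_mul2r le2 orbT.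
  have : z * z <= z ^ 3 by rewrite !expnS expn0 muln1 leq_mul // leq_pmulr.
  have : z * z * z = z ^ 3 by rewrite !expnS expn0 muln1 mulnA.
  move: oz hz1; rewrite /W; move: (z ^ 3) => c.
  move: ((size T + size K) * _) => q.
  move: (dsize (dlist (map old _))) (dsize (dlist (map fresh _))) (dsize (dlist (_ ++
      _))) => q1 q2 q3.
  by clear; lia.
have [l [X [l0 cor [t ex le]]]] := exec_extension_program nW (leq_trans oz zW)
  (leq_trans kz zW) (leq_trans mz zW) listW sol n0.
exists t, (sto l), (Some X); split=> //; first by rewrite initE.
by rewrite boundE.
Qed.

Theorem theorem2p1 (R : realType) :
  poly_time_equivalent (blocking_k_arborescences R)
    (blocking_rooted_k_arborescences R).
Proof. by split; [apply: unrooted_reducible|apply: rooted_reducible]. Qed.
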